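(* Let $\theta=(|\cdot|,\mathfrak s)\in\Theta_+$. Let $A$ and $B$ be two apartments of $\mathcal I$ containing $\mathfrak s$. Let $\rho:\mathcal I\to A$ be the retraction onto $A$ centered at $\mathfrak s$ and let $\phi:A\to B$ be the unique isomorphism of apartments fixing $A\cap B$. Then: 1. the distance $d_\theta|_{A^2}$ is induced by some norm on $A$; 2. for all $x\in\mathcal I$ and $u\in\overline{C^v_f}$, $\rho(x+_{\mathfrak s}u)=\rho(x)+_{\mathfrak s}u$; 3. the retraction $\rho:(\mathcal I,d_\theta)\to(A,d_\theta|_{A^2})$ is $1$-Lipschitz; 4. the map $\phi:(A,d_\theta|_{A^2})\to(B,d_\theta|_{B^2})$ is an isometry.
   Context: **Vectorial data.** $I$ is a finite set and $C=(c_{i,j})_{i,j\in I}$ is a Kac--Moody matrix: $c_{i,j}\in\mathbb Z$, $c_{i,i}=2$, $c_{i,j}\le 0$ for $i\neq j$, and $c_{i,j}=0\iff c_{j,i}=0$. $X,Y$ are dual free $\mathbb Z$-modules of finite rank with $\mathbb Z$-linearly independent families $(\alpha_i)_{i\in I}$ in $X$ and $(\alpha_i^\vee)_{i\in I}$ in $Y$ such that $\alpha_j(\alpha_i^\vee)=c_{i,j}$. $\mathbb A=Y\otimes\mathbb R$, with its usual topology; elements of $X$ are linear forms on $\mathbb A$. $r_i(v)=v-\alpha_i(v)\alpha_i^\vee$, and $W^v=\langle r_i\mid i\in I\rangle\subset \mathrm{GL}(\mathbb A)$ (Weyl group), acting on $\mathbb A^*$ by $(w.\alpha)(x)=\alpha(w^{-1}x)$.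 $\Phi=\{w.\alpha_i\}$ is the set of real roots; for $\alpha=w.\alpha_i\in\Phi$, $\alpha^\vee=w.\alpha_i^\vee$. $Q^\vee=\bigoplus_i\mathbb Z\alpha_i^\vee$ and $W^a=Q^\vee\rtimes W^v$. $\Delta\subset\bigoplus_i\mathbb Z\alpha_i\subset\mathbb A^*$ is the set of all (real and imaginary) roots of the Kac--Moody algebra of $C$. For $\alpha\in\mathbb A^*$, $k\in\mathbb R$: $D(\alpha,k)=\{\alpha(x)+k\ge0\}$, $D^\circ(\alpha,k)=\{\alpha(x)+k>0\}$, $M(\alpha,k)=\{\alpha(x)+k=0\}$, and $D(\alpha,+\infty)=D^\circ(\alpha,+\infty)=\mathbb A$. Walls (resp. half-apartments) are the $M(\alpha,k)$ (resp. $D(\alpha,k)$), $\alpha\in\Phi$, $k\in\mathbb Z$. $C^v_f=\{v\mid\alpha_i(v)>0\ \forall i\}$; for $J\subset I$, $F^v(J)=\{v\mid \alpha_i(v)=0\ (i\in J),\ \alpha_i(v)>0\ (i\notin J)\}$. Positive (resp. negative) vectorial faces are the $w.F^v(J)$ (resp. $-w.F^v(J)$), $w\in W^v$; vectorial chambers are the $\pm w.C^v_f$. Tits cone: $\mathcal T=\bigcup_{w}w.\overline{C^v_f}$. A vectorial face is spherical if it meets $\pm\mathring{\mathcal T}$. $x\le y$ means $y-x\in\mathcal T$. A ray or segment through $x\ne y$ from $x$ is preordered if $x\le y$ or $y\le x$, generic if $y-x\in\pm\mathring{\mathcal T}$. **Filters.** A filter lies in a set $Z$ if $Z$ is an element of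 it; a set (e.g. an apartment) contains a filter if it contains an element of it; a map fixes a filter if it fixes pointwise some element of it. The support of a filter is the smallest affine subspace containing it. $\mathcal F\Cup\mathcal F'=\{E\cup E'\mid E\in\mathcal F,E'\in\mathcal F'\}$. The enclosure $\mathrm{cl}(\mathcal F)$ of a filter on $\mathbb A$ is the filter of sets $E$ containing some $\bigcap_{\alpha\in\Delta}D(\alpha,k_\alpha)\in\mathcal F$ with $k_\alpha\in\mathbb Z\cup\{+\infty\}$ (a set is treated as its principal filter). A sector-face is $f=x+F^v$ ($F^v$ a vectorial face); its germ at infinity is the filter of sets containing $x+u+F^v$ for some $u\in\overline{F^v}$. If $F^v$ is a vectorial chamber, $f$ is a sector and its germ is a sector-germ, with the sign of $F^v$; $\pm\infty$ is the germ of $\pm C^v_f$. The face $F(x,F^v)$ is the filter of sets $E$ for which there are $k_\alpha,k'_\alpha\in\mathbb Z\cup\{+\infty\}$ $(\alpha\in\Delta)$ and a neighbourhood $\Omega$ of $x$ with $E\supset\bigcap_{\alpha}(D(\alpha,k_\alpha)\cap D^\circ(\alpha,k'_\alpha))\supset\Omega\cap(x+F^v)$. A chamber (resp. panel) is a face with support $\mathbb A$ (resp. a wall). A chimney is $\mathfrak r(F,F^v)=\mathrm{cl}(F+F^v)$, $F$ a face, $F^v$ a vectorial face; it is splayed if $F^v$ is spherical, solid if the pointwise stabilizer in $W^v$ of the direction of its support is finite. Its germ is the filter of sets belonging to some $\mathfrak r(F+u,F^v)$, $u\in\overline{F^v}$. **Apartments.** $\mathrm{Aut}(\mathbb A)$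 is the group of affine bijections of $\mathbb A$ stabilizing $\{(M(\alpha,k),\alpha^\vee)\mid\alpha\in\Phi,k\in\mathbb Z\}$. An apartment of type $\mathbb A$ is a set $A$ with a nonempty set $\mathrm{Isom}^w(\mathbb A,A)$ of bijections $\mathbb A\to A$ forming one orbit $f_0\circ W^a$. A bijection $\phi:A\to A'$ is a Weyl isomorphism (resp. an isomorphism, which here always means vectorially Weyl isomorphism) if $f'^{-1}\circ\phi\circ f\in W^a$ (resp. $\in(W^v\ltimes\mathbb A)\cap\mathrm{Aut}(\mathbb A)$) for $f\in\mathrm{Isom}^w(\mathbb A,A)$, $f'\in\mathrm{Isom}^w(\mathbb A,A')$. All above notions, the affine structure and the affine topology are transported to every apartment. A distance on an apartment is induced by a norm if it is $(x,y)\mapsto\|x-y\|$ for a norm on its underlying vector space. **Masure.** A masure of type $\mathbb A$ is a set $\mathcal I$ covered by a family of subsets called apartments such that: (MA1) each apartment has a structure of apartment of type $\mathbb A$. (MA2) If $F$ is a point, a germ of a preordered interval, a generic ray or a solid chimney in an apartment $A$, and $A'$ is another apartment containing $F$, then $A\cap A'$ contains $\mathrm{cl}_A(F)$ and there is a Weyl isomorphism $A\to A'$ fixing $\mathrm{cl}_A(F)$. (MA3) If $\mathfrak R$ is the germ of a splayed chimney and $F$ is a face or a germ of a solid chimney, some apartment contains $\mathfrak R$ and $F$. (MA4) If apartments $A,A'$ contain $\mathfrak R$ and $F$ as in (MA3), there is a Weyl isomorphism $A\to A'$ fixing $\mathrm{cl}_A(\mathfrak R\Cup F)$. (MAO) If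 $x,y\in A\cap A'$ and $x\le_A y$ then $[x,y]_A=[x,y]_{A'}$. Standing assumptions: $\mathcal I$ is such a masure; each panel lies in the closure of finitely many, and more than $2$, chambers; a group $G$ acts strongly transitively on $\mathcal I$ (it permutes apartments, each $g:A\to g.A$ is an isomorphism of apartments, and all isomorphisms in the axioms are induced by elements of $G$); $\mathbb A$ is identified with a fixed apartment of $\mathcal I$, and the stabilizer of $\mathbb A$ in $G$ induces on $\mathbb A$ the group $W^v\ltimes Y$. $\mathcal I$ is a building if and only if $W^v$ is finite. Sector-germs of $\mathcal I$ are sector-germs of its apartments (a sector-germ contained in an apartment $B$ is a sector-germ of $B$, of the same sign). **Retractions.** If apartments $A,B$ contain a common sector-germ $\mathfrak s$, there is a unique isomorphism $A\to B$ fixing $\mathfrak s$, and it is also the unique isomorphism fixing $A\cap B$ pointwise. If $A$ contains $\mathfrak s$, the retraction onto $A$ centered at $\mathfrak s$ sends $x\in\mathcal I$ to the image of $x$ under the isomorphism $A_x\to A$ fixing $\mathfrak s$, where $A_x$ is any apartment containing $x$ and $\mathfrak s$ (it exists, and the image is independent of the choice). **Distances.** Let $\mathfrak s$ be a sector-germ of sign $\mathrm{sgn}(\mathfrak s)\in\{+,-\}$, $x\in\mathcal I$, $u\in\overline{C^v_f}$. Choose an apartment $A_1$ containing $x$ and $\mathfrak s$ and an isomorphism $\psi:\mathbb A\to A_1$ with $\psi(\mathrm{sgn}(\mathfrak s)\infty)=\mathfrak s$; then $x+_{\mathfrak s}u:=\psi(\psi^{-1}(x)+\mathrm{sgn}(\mathfrak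 s)u)$ is independent of choices. $U_{\mathfrak s}(x,x')=\{(u,u')\in\overline{C^v_f}^2\mid x+_{\mathfrak s}u=x'+_{\mathfrak s}u'\}$, which is nonempty. $\Theta_+$ (resp. $\Theta_-$) is the set of pairs $\theta=(|\cdot|,\mathfrak s)$ with $|\cdot|$ a norm on $\mathbb A$ and $\mathfrak s$ a positive (resp. negative) sector-germ of $\mathcal I$. For such $\theta$, $d_\theta(x,x')=\inf\{|u|+|u'|\mid(u,u')\in U_{\mathfrak s}(x,x')\}$ is a distance on $\mathcal I$. *)

(* Defs.v *)
From HB Require Import structures.
From mathcomp Require Import all_boot all_order all_algebra.
From mathcomp Require Import complex.
From mathcomp Require Import all_classical all_reals all_analysis.

Set Implicit Arguments.
Unset Strict Implicit.
Unset Printing Implicit Defensive.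

Import Order.TTheory GRing.Theory Num.Theory numFieldNormedType.Exports.

Local Open Scope classical_set_scope.
Local Open Scope ring_scope.

(* The dual lattices X and Y are taken in dual bases: Y = Z^n (columns),
   X = Z^n (rows), paired by the matrix product. *)

Definition pair (K : pzRingType) n (a : 'rV[K]_n) (v : 'cV[K]_n) : K :=
  (a *m v) 0 0.

Record kmDatum := KMDatum {
  idx : finType;
  cartan : idx -> idx -> int;
  cartan_diag : forall i, cartan i i = 2%:Z;
  cartan_offdiag : forall i j, i != j -> cartan i j <= 0;
  cartan_zero : forall i j, cartan i j = 0 <-> cartan j i = 0;
  rk : nat;
  alpha : idx -> 'rV[int]_rk;
  alphav : idx -> 'cV[int]_rk;
  alpha_free : forall a : idx -> int,
    \sum_i a i *: alpha i = 0 -> forall i, a i = 0;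
  alphav_free : forall a : idx -> int,
    \sum_i a i *: alphav i = 0 -> forall i, a i = 0;
  pair_alpha : forall i j, pair (alpha j) (alphav i) = cartan i j }.

Definition alphaK (K : pzRingType) (S : kmDatum) (i : idx S) : 'rV[K]_(rk S) :=
  map_mx intr (alpha i).
Definition alphavK (K : pzRingType) (S : kmDatum) (i : idx S) : 'cV[K]_(rk S) :=
  map_mx intr (alphav i).
Arguments alphaK K {S} i.
Arguments alphavK K {S} i.

Section KacMoodyAlgebra.
Context (K : fieldType) (S : kmDatum).

(* Lie terms over generators e_i, f_i and the Cartan subalgebra h = Y (x) K;
   the quotient of [lieTerm] by [lieEq] is the Lie algebra g~ of Kac's book.
   Here h may be larger than in a minimal realization; this only enlarges the
   center and does not change the roots. *)
Inductive lieTerm : Type :=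
  | LE of idx S
  | LF of idx S
  | LH of 'cV[K]_(rk S)
  | L0
  | LAdd of lieTerm & lieTerm
  | LScale of K & lieTerm
  | LBr of lieTerm & lieTerm.

Inductive lieEq : lieTerm -> lieTerm -> Prop :=
  | lieEq_refl x : lieEq x x
  | lieEq_sym x y : lieEq x y -> lieEq y x
  | lieEq_trans x y z : lieEq x y -> lieEq y z -> lieEq x z
  | lieEq_add x x' y y' :
      lieEq x x' -> lieEq y y' -> lieEq (LAdd x y) (LAdd x' y')
  | lieEq_scale c x x' : lieEq x x' -> lieEq (LScale c x) (LScale c x')
  | lieEq_br x x' y y' :
      lieEq x x' -> lieEq y y' -> lieEq (LBr x y) (LBr x' y')
  | lie_addA x y z : lieEq (LAdd x (LAdd y z)) (LAdd (LAdd x y) z)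
  | lie_addC x y : lieEq (LAdd x y) (LAdd y x)
  | lie_add0 x : lieEq (LAdd L0 x) x
  | lie_addN x : lieEq (LAdd (LScale (-1) x) x) L0
  | lie_scale1 x : lieEq (LScale 1 x) x
  | lie_scaleA c d x : lieEq (LScale c (LScale d x)) (LScale (c * d) x)
  | lie_scaleDr c x y :
      lieEq (LScale c (LAdd x y)) (LAdd (LScale c x) (LScale c y))
  | lie_scaleDl c d x :
      lieEq (LScale (c + d) x) (LAdd (LScale c x) (LScale d x))
  | lie_brDl x y z : lieEq (LBr (LAdd x y) z) (LAdd (LBr x z) (LBr y z))
  | lie_brDr x y z : lieEq (LBr x (LAdd y z)) (LAdd (LBr x y) (LBr x z))
  | lie_brZl c x y : lieEq (LBr (LScale c x) y) (LScale c (LBr x y))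
  | lie_brZr c x y : lieEq (LBr x (LScale c y)) (LScale c (LBr x y))
  | lie_alt x : lieEq (LBr x x) L0
  | lie_jacobi x y z :
      lieEq (LAdd (LBr x (LBr y z)) (LAdd (LBr y (LBr z x)) (LBr z (LBr x y))))
            L0
  | lie_hD h h' : lieEq (LH (h + h')) (LAdd (LH h) (LH h'))
  | lie_hZ c h : lieEq (LH (c *: h)) (LScale c (LH h))
  | lie_hh h h' : lieEq (LBr (LH h) (LH h')) L0
  | lie_he h i : lieEq (LBr (LH h) (LE i)) (LScale (pair (alphaK K i) h) (LE i))
  | lie_hf h i :
      lieEq (LBr (LH h) (LF i)) (LScale (- pair (alphaK K i) h) (LF i))
  | lie_ef i : lieEq (LBr (LE i) (LF i)) (LH (alphavK K i))
  | lie_ef0 i j : i != j -> lieEq (LBr (LE i) (LF j)) L0.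

Record lieIdeal (J : lieTerm -> Prop) : Prop := LieIdeal {
  ideal_eq : forall x y, lieEq x y -> J x -> J y;
  ideal0 : J L0;
  idealD : forall x y, J x -> J y -> J (LAdd x y);
  idealZ : forall c x, J x -> J (LScale c x);
  ideal_br : forall x y, J y -> J (LBr x y) }.

(* The largest ideal of g~ meeting h trivially; g~ modulo it is the
   Kac-Moody algebra. *)
Definition kmRadical (x : lieTerm) : Prop :=
  exists J, [/\ lieIdeal J, forall h, J (LH h) -> lieEq (LH h) L0 & J x].

(* [sum_i a_i alpha_i] is a root: it is nonzero and its root space in the
   Kac-Moody algebra is nonzero. *)
Definition is_kmRoot (a : idx S -> int) : Prop :=
  (exists i, a i != 0) /\
  exists2 x, ~ kmRadical x &
    forall h : 'cV[K]_(rk S),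
      kmRadical (LAdd (LBr (LH h) x)
        (LScale (- pair (\sum_i (a i)%:~R *: alphaK K i) h) x)).

End KacMoodyAlgebra.

Section VectorialApartment.
Context (R : realType) (S : kmDatum).

Definition V := 'cV[R]_(rk S).
Definition Vdual := 'rV[R]_(rk S).

Definition Delta : set Vdual :=
  [set a | exists2 c : idx S -> int, is_kmRoot R[i] c &
             a = \sum_i (c i)%:~R *: alphaK R i].

Definition refl (i : idx S) : 'M[R]_(rk S) :=
  1%:M - alphavK R i *m alphaK R i.

(* the r_i are involutions, so the generated monoid is the generated group *)
Inductive weyl : 'M[R]_(rk S) -> Prop :=
  | weyl1 : weyl 1%:M
  | weylM i w : weyl w -> weyl (refl i *m w).

Definition aff (w : 'M[R]_(rk S)) (t v : V) : V := w *m v + t.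

Definition Wa : set (V -> V) :=
  [set a | exists w (c : idx S -> int), weyl w /\
             a = aff w (\sum_i (c i)%:~R *: alphavK R i)].

Definition WvY : set (V -> V) :=
  [set a | exists w (y : 'cV[int]_(rk S)), weyl w /\
             a = aff w (map_mx intr y)].

Definition realRoot : set (Vdual * V) :=
  [set p | exists w i, weyl w /\
             p = (alphaK R i *m invmx w, w *m alphavK R i)].

Definition Phi : set Vdual := [set p.1 | p in realRoot].

Definition D (a : Vdual) (k : option int) : set V :=
  if k is Some k then [set x | 0 <= pair a x + k%:~R] else setT.
Definition Do (a : Vdual) (k : option int) : set V :=
  if k is Some k then [set x | 0 < pair a x + k%:~R] else setT.
Definition wall (a : Vdual) (k : int) : set V :=
  [set x | pair a x + k%:~R = 0].

Definition wallCoroot : set (set V * V) :=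
  [set q | exists p k, realRoot p /\ q = (wall p.1 k, p.2)].

(* a = aff g t is an element of Aut(A) *)
Definition autA (g : 'M[R]_(rk S)) (t : V) : Prop :=
  g \in unitmx /\
  [set (aff g t @` q.1, g *m q.2) | q in wallCoroot] = wallCoroot.

Definition vwAut : set (V -> V) :=
  [set a | exists w t, [/\ weyl w, autA w t & a = aff w t]].

Variant sign := Plus | Minus.
Definition sgn (e : sign) : R := if e is Plus then 1 else -1.

Definition Cvf : set V := [set v | forall i, 0 < pair (alphaK R i) v].
Definition Fv (J : {set idx S}) : set V :=
  [set v | forall i, if i \in J then pair (alphaK R i) v = 0
                     else 0 < pair (alphaK R i) v].

Definition vchamber (e : sign) : set (set V) :=
  [set C | exists2 w, weyl w & C = [set sgn e *: (w *m v) | v in Cvf]].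
Definition vface : set (set V) :=
  [set F | exists e w J, weyl w /\ F = [set sgn e *: (w *m v) | v in Fv J]].

Definition tits : set V :=
  [set x | exists2 w, weyl w & exists2 v, closure Cvf v & x = w *m v].
Definition titsInt (e : sign) : set V := [set sgn e *: v | v in interior tits].

Definition spherical (F : set V) : Prop :=
  exists e, F `&` titsInt e !=set0.

Definition leT (x y : V) : Prop := tits (y - x).
Definition preordered (x y : V) : Prop := leT x y \/ leT y x.

(* Filters on the apartment are upward closed set systems. *)

Definition principal (Z : set V) : set_system V := [set E | Z `<=` E].

Definition seg (x y : V) : set V :=
  [set x + t *: (y - x) | t in [set t : R | 0 <= t <= 1]].
Definition ray (x y : V) : set V :=
  [set x + t *: (y - x) | t in [set t : R | 0 <= t]].
Definition segGerm (x y : V) : set_system V :=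
  [set E | exists2 Om, nbhs x Om & Om `&` seg x y `<=` E].

Definition cl (F : set_system V) : set_system V :=
  [set E | exists2 k : Vdual -> option int,
             F (\bigcap_(a in Delta) D a (k a)) &
             \bigcap_(a in Delta) D a (k a) `<=` E].

Definition affsub (p : V) (L : {vspace V}) : set V := [set x | x - p \in L].
(* the support of F is the affine subspace p + L *)
Definition is_support (F : set_system V) (p : V) (L : {vspace V}) : Prop :=
  F (affsub p L) /\
  forall p' L', F (affsub p' L') -> affsub p L `<=` affsub p' L'.

Definition face (x : V) (F : set V) : set_system V :=
  [set E | exists (k k' : Vdual -> option int) (Om : set V),
     [/\ nbhs x Om,
         \bigcap_(a in Delta) (D a (k a) `&` Do a (k' a)) `<=` E &
         Om `&` [set x + v | v in F] `<=`
           \bigcap_(a in Delta) (D a (k a) `&` Do a (k' a))]].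
Definition is_face (F : set_system V) : Prop :=
  exists x, exists2 Fv, vface Fv & F = face x Fv.
Definition is_chamber (F : set_system V) : Prop :=
  is_face F /\ exists p, is_support F p fullv.
Definition is_panel (F : set_system V) : Prop :=
  is_face F /\ exists p L, is_support F p L /\
    exists2 a, Phi a & exists k, affsub p L = wall a k.

Definition filterClosure (F : set_system V) : set_system V :=
  [set E | exists2 Z, F Z & closure Z `<=` E].

Definition sectorGerm (x : V) (C : set V) : set_system V :=
  [set E | exists2 u, closure C u & [set x + u + v | v in C] `<=` E].

Definition addFilter (F : set_system V) (C : set V) : set_system V :=
  [set E | exists2 Z, F Z & [set z + v | z in Z & v in C] `<=` E].
Definition translFilter (F : set_system V) (u : V) : set_system V :=
  fmap (fun x => x + u) F.

Definition chimney (F : set_system V) (C : set V) : set_system V :=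
  cl (addFilter F C).
Definition chimneyGerm (F : set_system V) (C : set V) : set_system V :=
  [set E | exists2 u, closure C u & chimney (translFilter F u) C E].

Definition splayed (C : set V) : Prop := spherical C.
Definition solid (F : set_system V) (C : set V) : Prop :=
  exists p L, is_support (chimney F C) p L /\
    finite_set [set w | weyl w /\ forall v, v \in L -> w *m v = v].

Variant ma2Filter : set_system V -> Prop :=
  | ma2_point x : ma2Filter (principal [set x])
  | ma2_germ x y : x <> y -> preordered x y -> ma2Filter (segGerm x y)
  | ma2_ray x y e : x <> y -> titsInt e (y - x) -> ma2Filter (principal (ray x y))
  | ma2_chimney F C : is_face F -> vface C -> solid F C ->
      ma2Filter (chimney F C).

Definition is_norm (N : V -> R) : Prop :=
  [/\ forall x y, N (x + y) <= N x + N y,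
      forall (c : R) x, N (c *: x) = `|c| * N x &
      forall x, N x = 0 -> x = 0].

End VectorialApartment.

(* The bijections from the model apartment onto A are given as injective maps
   V R S -> M with range A. *)
Record aptSystem (R : realType) (S : kmDatum) := AptSystem {
  pt :> Type;
  apt : set (set pt);
  isomw : set pt -> set (V R S -> pt) }.

Section Masures.
Context (R : realType) (S : kmDatum) (M : aptSystem R S).
Local Notation V := (V R S).
Implicit Types (A B : set M) (f : V -> M).

(* A filter on the apartment with chart f is seen as the filter [fmap f _] on
   the whole space; [pull] goes back, for a filter contained in the apartment. *)
Definition pull f (F : set_system M) : set_system V := [set Z | F (f @` Z)].

Definition contains A (F : set_system M) : Prop := exists2 E, F E & E `<=` A.
Definition fixes (phi : M -> M) (F : set_system M) : Prop :=
  exists2 E, F E & forall p, E p -> phi p = p.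
Definition cupFilter (F F' : set_system M) : set_system M :=
  [set Z | exists E E', [/\ F E, F' E' & Z = E `|` E']].

(* [phi] restricts to a Weyl isomorphism, resp. a (vectorially Weyl)
   isomorphism, A -> B; its values outside A are irrelevant *)
Definition weylIsom A B (phi : M -> M) : Prop :=
  forall f f', isomw A f -> isomw B f' ->
    exists2 a, @Wa R S a & forall v, phi (f v) = f' (a v).
Definition isom A B (phi : M -> M) : Prop :=
  forall f f', isomw A f -> isomw B f' ->
    exists2 a, @vwAut R S a & forall v, phi (f v) = f' (a v).
Definition modelIsom A (psi : V -> M) : Prop :=
  forall f, isomw A f -> exists2 a, @vwAut R S a & forall v, psi v = f (a v).

Definition faceIn (F : set_system M) : Prop :=
  exists A f F0, [/\ apt A, isomw A f, is_face F0 & F = fmap f F0].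
Definition chamberIn (F : set_system M) : Prop :=
  exists A f F0, [/\ apt A, isomw A f, is_chamber F0 & F = fmap f F0].
Definition panelIn (F : set_system M) : Prop :=
  exists A f F0, [/\ apt A, isomw A f, is_panel F0 & F = fmap f F0].
Definition splayedGermIn (F : set_system M) : Prop :=
  exists A f F0 C, [/\ apt A, isomw A f, is_face F0, vface C & splayed C] /\
    F = fmap f (chimneyGerm F0 C).
Definition solidGermIn (F : set_system M) : Prop :=
  exists A f F0 C, [/\ apt A, isomw A f, is_face F0, vface C & solid F0 C] /\
    F = fmap f (chimneyGerm F0 C).
Definition sectorGermIn (e : sign) (F : set_system M) : Prop :=
  exists A f x C, [/\ apt A, isomw A f, vchamber e C & F = fmap f (sectorGerm x C)].

(* F is viewed in A through the chart f *)
Definition ma2Config A B f (F : set_system V) : Prop :=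
  [/\ apt A, apt B, isomw A f, ma2Filter F & contains B (fmap f F)].

Definition ma4Config A B f (Q F : set_system M) : Prop :=
  [/\ apt A, apt B & isomw A f] /\
  [/\ splayedGermIn Q, faceIn F \/ solidGermIn F,
      contains A Q /\ contains A F & contains B Q /\ contains B F].

Record is_masure : Prop := IsMasure {
  masure_cover : forall p : M, exists2 A, apt A & A p;
  MA1_nonempty : forall A, apt A -> isomw A !=set0;
  MA1_bij : forall A f, apt A -> isomw A f -> injective f /\ range f = A;
  MA1_orbit : forall A f g, apt A -> isomw A f ->
    (isomw A g <-> exists2 a, @Wa R S a & g = f \o a);
  MA2 : forall A B f (F : set_system V), ma2Config A B f F ->
    contains (A `&` B) (fmap f (cl F)) /\
    exists2 phi, weylIsom A B phi & fixes phi (fmap f (cl F));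
  MA3 : forall Q F, splayedGermIn Q -> faceIn F \/ solidGermIn F ->
    exists2 A, apt A & contains A Q /\ contains A F;
  MA4 : forall A B f Q F, ma4Config A B f Q F ->
    exists2 phi, weylIsom A B phi &
      fixes phi (fmap f (cl (pull f (cupFilter Q F))));
  MAO : forall A B f g x y x' y', apt A -> apt B -> isomw A f -> isomw B g ->
    f x = g x' -> f y = g y' -> leT x y ->
    [set f v | v in seg x y] = [set g v | v in seg x' y'] }.

(* P lies in the closure of C: as set systems, inclusion of filters is
   reversed *)
Definition in_closure (P C : set_system M) : Prop :=
  exists A f C0, [/\ apt A, isomw A f, is_chamber C0, C = fmap f C0 &
    fmap f (filterClosure C0) `<=` P].

Definition thick : Prop := forall P, panelIn P ->
  let Ch := [set C | chamberIn C /\ in_closure P C] in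
  finite_set Ch /\ ~ (Ch #<= `I_2)%card.

Record strongly_transitive (G : groupType) (act : G -> M -> M) : Prop := {
  act1 : forall p, act 1%g p = p;
  actM : forall g h p, act (g * h)%g p = act g (act h p);
  act_apt : forall g A, apt A -> apt (act g @` A);
  act_isom : forall g A, apt A -> isom A (act g @` A) (act g);
  act_MA2 : forall A B f F phi, ma2Config A B f F ->
    weylIsom A B phi -> fixes phi (fmap f (cl F)) ->
    exists g, forall p, A p -> act g p = phi p;
  act_MA4 : forall A B f Q F phi, ma4Config A B f Q F ->
    weylIsom A B phi -> fixes phi (fmap f (cl (pull f (cupFilter Q F)))) ->
    exists g, forall p, A p -> act g p = phi p }.

(* the permutations of the model induced by the stabilizer in G of the
   apartment A, identified with the model through the chart f *)
Definition inducedStab (G : groupType) (act : G -> M -> M) A f : set (V -> V) :=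
  [set a | exists2 g, act g @` A = A & forall v, act g (f v) = f (a v)].

Definition retraction A (s : set_system M) (rho : M -> M) : Prop :=
  forall p A' psi, apt A' -> A' p -> contains A' s ->
    isom A' A psi -> fixes psi s -> rho p = psi p.

Definition is_splus (e : sign) (s : set_system M) (p : M) (u : V) (q : M) :=
  exists A psi, [/\ apt A, A p, contains A s, modelIsom A psi &
    fmap psi (sectorGerm 0 [set sgn R e *: v | v in @Cvf R S]) = s /\
    exists2 v, psi v = p & q = psi (v + sgn R e *: u)].

(* p +_s u, for s of sign e (when the Weyl group is finite a sector-germ has both
   signs, so the sign is a parameter); the default value p is never used for u in the
   closure of C^v_f *)
Definition splus (e : sign) (s : set_system M) (p : M) (u : V) : M :=
  xget (p : {classic M}) (is_splus e s p u).

Definition U (e : sign) (s : set_system M) (p q : M) : set (V * V) :=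
  [set uu | [/\ closure (@Cvf R S) uu.1, closure (@Cvf R S) uu.2 &
              splus e s p uu.1 = splus e s q uu.2]].

Definition Theta (e : sign) (N : V -> R) (s : set_system M) : Prop :=
  is_norm N /\ sectorGermIn e s.

Definition dist (e : sign) (N : V -> R) (s : set_system M) (p q : M) : R :=
  inf [set N uu.1 + N uu.2 | uu in U e s p q].

Definition inducedByNorm A (d : M -> M -> R) : Prop :=
  forall f, isomw A f ->
    exists2 N, is_norm N & forall x y, d (f x) (f y) = N (x - y).

End Masures.

(* Main.v *)
Require Import Defs.
From mathcomp Require Import all_boot all_order all_algebra.
From mathcomp Require Import complex ring lra.
From mathcomp Require Import all_classical all_reals all_analysis.
From Corelib Require ssrsetoid.

Set Implicit Arguments.
Unset Strict Implicit.
Unset Printing Implicit Defensive.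

Import Order.TTheory GRing.Theory Num.Theory numFieldNormedType.Exports.
Local Open Scope classical_set_scope.
Local Open Scope ring_scope.

(* Charts of apartments that send the germ at infinity of C^v_f to s play the
   role of coordinates. In an apartment containing s, two of them differ by a
   translation, because an element of W^v mapping a point of the open chamber
   into the chamber is trivial. If two apartments contain both s and p, (MA4)
   gives an isomorphism fixing an enclosed set that contains p and a subsector
   of s; as every root is a nonnegative or a nonpositive combination of simple
   roots, this set contains p + closure(C^v_f), so that [x +_s u] is v |-> v + u
   in such charts and commutes with rho and phi. In every apartment d_theta then
   becomes the norm z |-> inf {|u| + |u'| : z + u = u'} of the difference. *)

(** * Roots have coefficients of constant sign *)

(** Enclosures are cut out by all roots, imaginary ones included, so the constant sign of the
    coefficients has to come from the Kac-Moody algebra itself, which is given only by generators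
    and relations modulo a radical. The argument there writes every element as a sum of weight
    vectors whose weights have constant sign, and separates these weights from any other by one
    integral vector h. The Weyl group is given as a group of matrices, so the positivity of simple
    roots on chambers is obtained from words in the reflections, by reduction to two generators.
    Finally (MA3) and (MA4) speak of faces and chimneys: a point x enters through the face at x of
    direction F^v(I), on which all roots are constant, and s enters through germs of chimneys of
    direction C^v_f. *)

Lemma pairDl (K : pzRingType) n (a b : 'rV[K]_n) h :
  pair (a + b) h = pair a h + pair b h.
Proof. by rewrite /pair mulmxDl mxE. Qed.

Lemma pairZl (K : pzRingType) n c (a : 'rV[K]_n) h :
  pair (c *: a) h = c * pair a h.
Proof. by rewrite /pair -scalemxAl mxE. Qed.

Lemma pairBl (K : pzRingType) n (a b : 'rV[K]_n) h :
  pair (a - b) h = pair a h - pair b h.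
Proof. by rewrite /pair mulmxBl !mxE. Qed.

Section TriangularDecomposition.
Context (K : numFieldType) (S : kmDatum).
Local Notation term := (lieTerm K S).
Local Notation "x ~~ y" := (lieEq x y) (at level 70).
Implicit Types (x y z : term) (b : bool) (i j : idx S).

Local Instance lieEq_equiv : RelationClasses.Equivalence (@lieEq K S).
Proof.
split; first exact: lieEq_refl.
- by move=> x y; exact: lieEq_sym.
- by move=> x y z; exact: lieEq_trans.
Qed.

Local Hint Resolve lieEq_refl : core.

Local Instance LAdd_proper :
  Morphisms.Proper (Morphisms.respectful (@lieEq K S)
    (Morphisms.respectful (@lieEq K S) (@lieEq K S))) (@LAdd K S).
Proof. by move=> x x' xx' y y' yy'; exact: lieEq_add. Qed.

Local Instance LScale_proper c :
  Morphisms.Proper (Morphisms.respectful (@lieEq K S) (@lieEq K S))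
    (@LScale K S c).
Proof. by move=> x x' xx'; exact: lieEq_scale. Qed.

Local Instance LBr_proper :
  Morphisms.Proper (Morphisms.respectful (@lieEq K S)
    (Morphisms.respectful (@lieEq K S) (@lieEq K S))) (@LBr K S).
Proof. by move=> x x' xx' y y' yy'; exact: lieEq_br. Qed.

Local Notation lopp x := (LScale (-1) x).
Local Notation zero := (L0 K S).

Lemma lie_addr0 x : LAdd x zero ~~ x.
Proof. by rewrite lie_addC lie_add0. Qed.

Lemma lie_addIr x y z : LAdd x z ~~ LAdd y z -> x ~~ y.
Proof.
move=> h; rewrite -(lie_addr0 x) -(lie_addr0 y) -(lie_addN z).
by rewrite (lie_addC _ z) !lie_addA h.
Qed.

Lemma lie_scale0 x : LScale 0 x ~~ zero.
Proof.
apply: (@lie_addIr _ _ x); rewrite lie_add0 -{2}[x]lie_scale1 -lie_scaleDl.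
by rewrite add0r lie_scale1.
Qed.

Lemma lie_scaler0 c : LScale c zero ~~ zero.
Proof. by rewrite -{1}(lie_scale0 zero) lie_scaleA mulr0 lie_scale0. Qed.

Lemma lie_br0x x : LBr zero x ~~ zero.
Proof. by rewrite -{1}(lie_scale0 zero) lie_brZl lie_scale0. Qed.

Lemma lie_brx0 x : LBr x zero ~~ zero.
Proof. by rewrite -{1}(lie_scale0 zero) lie_brZr lie_scale0. Qed.

Lemma lie_oppE x y : LAdd x y ~~ zero -> x ~~ lopp y.
Proof. by move=> h; apply: (@lie_addIr _ _ y); rewrite h lie_addN. Qed.

Lemma lie_brC x y : LBr x y ~~ lopp (LBr y x).
Proof.
apply: lie_oppE.
have := lie_alt (LAdd x y).
by rewrite lie_brDl !lie_brDr !lie_alt lie_add0 lie_addr0.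
Qed.

Lemma lie_oppK x : lopp (lopp x) ~~ x.
Proof. by rewrite lie_scaleA mulrNN mulr1 lie_scale1. Qed.

Lemma lie_leibniz x y z :
  LBr x (LBr y z) ~~ LAdd (LBr (LBr x y) z) (LBr y (LBr x z)).
Proof.
have := lie_jacobi x y z; move/lie_oppE => ->.
rewrite lie_scaleDr lie_addC.
rewrite (lie_brC z (LBr x y)) lie_oppK.
by rewrite (lie_brC z x) lie_brZr lie_oppK.
Qed.

Lemma lie_leibnizl x y z :
  LBr (LBr x y) z ~~ LAdd (LBr x (LBr y z)) (lopp (LBr y (LBr x z))).
Proof.
rewrite (lie_leibniz x y z) -lie_addA (lie_addC (LBr y _)) lie_addN.
by rewrite lie_addr0.
Qed.

Definition lie_gen b i : term := if b then LE K i else LF K i.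

(* Iterated brackets of the e_i (b = true) or of the f_i (b = false), with
   their weight in the basis of simple roots. *)
Inductive mono b : (idx S -> int) -> term -> Prop :=
  | mono_gen i :
      mono b (fun j => (if b then 1 else -1) * (i == j)%:R) (lie_gen b i)
  | mono_br l m x y :
      mono b l x -> mono b m y -> mono b (fun j => l j + m j) (LBr x y).

Inductive span_h (P : term -> Prop) : term -> Prop :=
  | span_eq x y : x ~~ y -> span_h P x -> span_h P y
  | span_add x y : span_h P x -> span_h P y -> span_h P (LAdd x y)
  | span_scale c x : span_h P x -> span_h P (LScale c x)
  | span_h_in h : span_h P (LH h)
  | span_in x : P x -> span_h P x.

Definition wt (l : idx S -> int) : 'rV[K]_(rk S) :=
  \sum_i (l i)%:~R *: alphaK K i.

Lemma wtD l m : wt (fun j => l j + m j) = wt l + wt m.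
Proof.
by rewrite /wt -big_split /=; apply: eq_bigr => i _; rewrite rmorphD scalerDl.
Qed.

Lemma wt_gen c i : wt (fun j => c * (i == j)%:R) = c%:~R *: alphaK K i.
Proof.
rewrite /wt (bigD1 i) //= eqxx mulr1 big1 ?addr0 // => j /negbTE ji.
by rewrite eq_sym ji mulr0 scale0r.
Qed.

Definition weight_vector l x : Prop :=
  forall h, LBr (LH h) x ~~ LScale (pair (wt l) h) x.

Lemma mono_weight b l x : mono b l x -> weight_vector l x.
Proof.
elim=> [i|{}l m {}x y _ IHx _ IHy] h.
  rewrite wt_gen pairZl /lie_gen; case: b.
    by rewrite mul1r; exact: lie_he.
  by rewrite mulN1r; exact: lie_hf.
rewrite lie_leibniz IHx IHy lie_brZl lie_brZr -lie_scaleDl.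
by rewrite -pairDl -wtD.
Qed.

Lemma mono_pure b l x : mono b l x ->
  forall i, if b then 0 <= l i else l i <= 0.
Proof.
elim=> [i|{}l m {}x y _ IHx _ IHy] k.
  by case: b; case: (i == k).
by move: {IHx IHy}(IHx k) (IHy k); case: b => ? ?; lra.
Qed.

Lemma span_0 P : span_h P zero.
Proof. exact: (span_eq (lie_scale0 (LH 0)) (span_scale _ (span_h_in _ _))). Qed.

Lemma span_mono (P Q : term -> Prop) x :
  (forall y, P y -> Q y) -> span_h P x -> span_h Q x.
Proof.
move=> PQ; elim=> {x}.
- by move=> x y xy _; exact: span_eq.
- by move=> x y _ ? _ ?; exact: span_add.
- by move=> c x _ ?; exact: span_scale.
- by move=> h; exact: span_h_in.
- by move=> x /PQ; exact: span_in.
Qed.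

Lemma span_brr (P : term -> Prop) z x :
  (forall h, span_h P (LBr z (LH h))) ->
  (forall y, P y -> span_h P (LBr z y)) ->
  span_h P x -> span_h P (LBr z x).
Proof.
move=> Ph PP; elim=> {x}.
- by move=> x y xy _; apply: span_eq; rewrite xy.
- move=> x y _ px _ py; apply: span_eq (span_add px py).
  by rewrite lie_brDr.
- by move=> c x _ px; apply: span_eq (span_scale c px); rewrite lie_brZr.
- exact: Ph.
- exact: PP.
Qed.

Lemma span_brC P x y : span_h P (LBr x y) -> span_h P (LBr y x).
Proof.
by move=> pxy; apply: span_eq (span_scale (-1) pxy); rewrite lie_brC lie_oppK.
Qed.

Let half b x := exists l, mono b l x.
Let anymono x := exists b, half b x.

(** Bracketing with a generator of the other sign is a derivation, and on a single generator it
    gives a coroot or 0. The brackets with elements of h that arise stay in the span because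
    iterated brackets are weight vectors. *)
Lemma span_br_opposite b i x : half b x ->
  span_h (half b) (LBr (lie_gen (~~ b) i) x).
Proof.
case=> l; elim=> [j|{}l m {}x y mx IHx my IHy].
  case: b; rewrite /lie_gen /=; last first.
    have [<-|ij] := eqVneq i j.
      by apply: span_eq (span_h_in _ (alphavK K i)); exact/lieEq_sym/lie_ef.
    by apply: span_eq (span_0 _); rewrite (lie_ef0 K ij).
  apply: span_brC; have [<-|ij] := eqVneq j i.
    by apply: span_eq (span_h_in _ (alphavK K j)); exact/lieEq_sym/lie_ef.
  by apply: span_eq (span_0 _); rewrite (lie_ef0 K ij).
have aux k z w : mono b k z -> span_h (half b) w -> span_h (half b) (LBr z w).
  move=> mz; apply: span_brr => [h|w' [m' mw']].
    apply: span_brC; apply: span_eq (span_scale (pair (wt k) h) (span_in _)).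
      by rewrite (mono_weight mz).
    by exists k.
  by apply: span_in; exists (fun j => k j + m' j); exact: mono_br.
apply: (@span_eq _ (LAdd (LBr (LBr (lie_gen (~~ b) i) x) y)
                         (LBr x (LBr (lie_gen (~~ b) i) y)))).
  by apply: lieEq_sym; exact: lie_leibniz.
by apply: span_add; [apply: span_brC; exact: aux my IHx|exact: aux mx IHy].
Qed.

Lemma span_br_gen b i x : span_h anymono x ->
  span_h anymono (LBr (lie_gen b i) x).
Proof.
apply: span_brr => [h|y [b' hy]].
  apply: span_brC; apply: span_eq (span_scale _ (span_in _)).
    by rewrite (mono_weight (mono_gen b i)).
  by exists b; eexists; exact: mono_gen.
have [bb'|bb'] := eqVneq b b'.
  rewrite {}bb'; case: hy => m my; apply: span_in; exists b'; eexists.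
  by apply: mono_br my; exact: mono_gen.
have -> : b = ~~ b' by case: b b' bb' {hy} => -[].
by apply: span_mono (span_br_opposite i hy) => z; exists b'.
Qed.

(* The elements whose bracket preserves the span form a subalgebra
   containing the generators. *)
Lemma span_br x y : span_h anymono y -> span_h anymono (LBr x y).
Proof.
elim: x y => [i|i|h||x IHx x' IHx'|c x IHx|x IHx x' IHx'] y py.
- exact: (@span_br_gen true).
- exact: (@span_br_gen false).
- apply: span_brr py => [h'|z [b [l mz]]].
    by apply: span_eq (span_0 _); rewrite lie_hh.
  apply: span_eq (span_scale (pair (wt l) h) (span_in _)).
    by rewrite (mono_weight mz).
  by exists b, l.
- by apply: span_eq (span_0 _); rewrite lie_br0x.
- by apply: span_eq (span_add (IHx _ py) (IHx' _ py)); rewrite lie_brDl.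
- by apply: span_eq (span_scale c (IHx _ py)); rewrite lie_brZl.
- apply: span_eq (span_add (IHx _ (IHx' _ py))
    (span_scale (-1) (IHx' _ (IHx _ py)))).
  by rewrite lie_leibnizl.
Qed.

(** This is the spanning half of the triangular decomposition n_- + h + n_+ of g~. *)
Lemma span_all x : span_h anymono x.
Proof.
elim: x => [i|i|h||x IHx x' IHx'|c x IHx|x IHx x' IHx'].
- by apply: span_in; exists true; eexists; exact: (mono_gen true i).
- by apply: span_in; exists false; eexists; exact: (mono_gen false i).
- exact: span_h_in.
- exact: span_0.
- exact: span_add.
- exact: span_scale.
- exact: span_br.
Qed.

Definition pure (l : idx S -> int) :=
  (forall i, 0 <= l i) \/ (forall i, l i <= 0).

(** Components may be zero and weights may repeat. Listing the weights lets [eigenvector_in_ideal]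
    remove them one at a time. *)
Fixpoint decomp (L : seq (idx S -> int)) y : Prop :=
  if L is l :: L' then
    exists x z, [/\ weight_vector l x, decomp L' z & y ~~ LAdd x z]
  else y ~~ zero.

Lemma decomp_eq L x y : x ~~ y -> decomp L x -> decomp L y.
Proof.
case: L => [|l L] /= xy; first by rewrite xy.
by move=> [u [v [hu hv]]]; rewrite xy => e; exists u, v; split.
Qed.

Lemma decomp_cat L L' x y :
  decomp L x -> decomp L' y -> decomp (L ++ L') (LAdd x y).
Proof.
elim: L x => [|l L IH] x /=.
  by move=> x0 dy; apply: decomp_eq dy; rewrite x0 lie_add0.
move=> [u [v [hu hv xuv]]] dy; exists u, (LAdd v y); split=> //.
  exact: IH.
by rewrite xuv lie_addA.
Qed.

Lemma weight_scale l c x : weight_vector l x -> weight_vector l (LScale c x).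
Proof. by move=> lx h; rewrite lie_brZr lx !lie_scaleA mulrC. Qed.

Lemma decomp_scale L c x : decomp L x -> decomp L (LScale c x).
Proof.
elim: L x => [|l L IH] x /=; first by move=> ->; exact: lie_scaler0.
move=> [u [v [hu hv xuv]]]; exists (LScale c u), (LScale c v); split.
- exact: weight_scale.
- exact: IH.
- by rewrite xuv lie_scaleDr.
Qed.

Lemma weight_decomposition x :
  exists2 L, decomp L x & forall l, List.In l L -> pure l.
Proof.
elim: (span_all x) => {x}.
- by move=> x y xy _ [L dx pL]; exists L => //; exact: decomp_eq dx.
- move=> x y _ [L dx pL] _ [L' dy pL']; exists (L ++ L').
    exact: decomp_cat.
  by move=> l lL; case: (List.in_app_or _ _ _ lL) => [/pL|/pL'].
- by move=> c x _ [L dx pL]; exists L => //; exact: decomp_scale.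
- move=> h; exists [:: fun=> 0] => /=; last first.
    by move=> l [<-|//]; left.
  exists (LH h), zero; split; rewrite ?lie_addr0 // => h'.
  have -> : wt (fun=> 0) = 0 by apply: big1 => i _; rewrite scale0r.
  by rewrite lie_hh /pair mul0mx mxE lie_scale0.
- move=> x [b [l mx]]; exists [:: l] => /=.
    exists x, zero; split; rewrite ?lie_addr0 //.
    exact: mono_weight mx.
  move=> _ [<-|//]; have := mono_pure mx.
  by case: b {mx} => ?; [left|right].
Qed.

(* [x |-> [h, x] - l(h) x] kills the l-component of x and acts on x modulo J
   by the nonzero scalar a(h) - l(h). *)
Lemma eigenvector_in_ideal (J : term -> Prop) h (c : K) L x : lieIdeal J ->
  decomp L x -> (forall l, List.In l L -> pair (wt l) h != c) ->
  J (LAdd (LBr (LH h) x) (LScale (- c) x)) -> J x.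
Proof.
move=> idJ; elim: L x => [|l L IH] x /=.
  by move=> x0 _ _; apply: ideal_eq idJ _ _ (lieEq_sym x0) (ideal0 idJ).
move=> [u [v [hu hv xuv]]] hc Jx.
pose D a y := LAdd (LBr (LH h) y) (LScale (- a) y).
have Deq a y z : y ~~ z -> D a y ~~ D a z by move=> yz; rewrite /D yz.
set lh := pair (wt l) h in hc.
have Dx : decomp L (D lh x).
  have e : D lh v ~~ D lh x.
    rewrite (Deq _ _ _ xuv) /D lie_brDr lie_scaleDr hu -/lh.
    rewrite -(lie_addA (LScale lh u)) (lie_addA (LBr _ v)).
    rewrite (lie_addC (LBr _ v) (LScale _ u)) -lie_addA lie_addA.
    by rewrite -lie_scaleDl subrr lie_scale0 lie_add0.
  apply: decomp_eq e _; rewrite /D.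
  elim: L v hv {IH hc xuv} => [|l' L IH] v /=.
    by move=> ->; rewrite lie_brx0 lie_scaler0 lie_add0.
  move=> [u' [v' [hu' hv' vE]]]; exists (D lh u'), (D lh v'); split.
  - move=> h'; rewrite /D lie_brDr lie_brZr hu' lie_brZr hu' lie_scaleDr.
    by rewrite !lie_scaleA; rewrite (mulrC (pair (wt l') h)) (mulrC (- lh)).
  - exact: IH.
  - rewrite vE /D lie_brDr lie_scaleDr -!lie_addA; apply: lieEq_add => //.
    by rewrite lie_addA (lie_addC (LBr _ v')) -lie_addA.
have JD : J (D lh x).
  apply: IH Dx _ _ => [l' l'L|]; first by apply: hc; right.
  apply: ideal_eq idJ _ _ _ (idealD idJ (ideal_br idJ (LH h) Jx)
    (idealZ idJ (- lh) Jx)).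
  rewrite /D !lie_brDr !lie_scaleDr !lie_brZr !lie_scaleA (mulrC (- lh)).
  rewrite -!lie_addA; apply: lieEq_add => //.
  rewrite !lie_addA; apply: lieEq_add => //.
  exact: lie_addC.
have J2 : J (LScale (lh - c) x).
  apply: ideal_eq idJ _ _ _ (idealD idJ Jx (idealZ idJ (-1) JD)).
  rewrite /D lie_scaleDr lie_scaleA mulN1r opprK.
  rewrite -lie_addA (lie_addA (LScale (- c) x)) (lie_addC (LScale (- c) x)).
  rewrite -lie_addA lie_addA (lie_addC (LBr _ x)) lie_addN lie_add0.
  by rewrite -lie_scaleDl addrC.
have nz : lh - c != 0 by rewrite subr_eq0; apply: hc; left.
apply: ideal_eq idJ _ _ _ (idealZ idJ (lh - c)^-1 J2).
by rewrite lie_scaleA mulVf // lie_scale1.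
Qed.

End TriangularDecomposition.

(* h = (1, t, t^2, ...) for a natural t that is not a root of the product of
   the polynomials with coefficients in s. *)
Lemma separating_vector n (s : seq 'rV[int]_n) : all (fun b => b != 0) s ->
  exists h : 'cV[int]_n, all (fun b => pair b h != 0) s.
Proof.
move=> s0; pose p (b : 'rV[int]_n) := \sum_(j < n) b 0 j *: 'X^j : {poly int}.
have pE b t : (p b).[t] = pair b (\col_j t ^+ j).
  rewrite /p horner_sum /pair mxE; apply: eq_bigr => j _.
  by rewrite hornerZ hornerXn mxE.
have p0 b : b != 0 -> p b != 0.
  apply: contra_neq => pb; apply/rowP => j; rewrite mxE.
  have := congr1 (fun q : {poly int} => q`_j) pb; rewrite /p coef0 coef_sum.
  rewrite (bigD1 j) //= coefZ coefXn eqxx mulr1 big1 ?addr0 // => k kj.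
  by rewrite coefZ coefXn eq_sym (inj_eq val_inj) (negbTE kj) mulr0.
pose q := \prod_(b <- s) p b.
have q0 : q != 0.
  by rewrite prodf_seq_neq0; apply/allP => b bs; apply: p0; exact: (allP s0).
have /allPn[t _ qt] : ~~ all (root q) [seq k%:R | k <- iota 0 (size q)].
  apply/negP => rq.
  suff u : uniq [seq (k%:R : int) | k <- iota 0 (size q)] :> bool.
    by have := max_poly_roots q0 rq u; rewrite size_map size_iota ltnn.
  by rewrite map_inj_uniq ?iota_uniq // => i j /eqP; rewrite eqr_nat => /eqP.
exists (\col_j t ^+ j); apply/allP => b bs; rewrite -pE.
apply: contraNneq qt => pbt; rewrite /root /q horner_prod.
by rewrite prodf_seq_eq0; apply/hasP; exists b; rewrite ?pbt.
Qed.

Lemma pair_intr (K : numFieldType) n (b : 'rV[int]_n) (h : 'cV[int]_n) :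
  pair (map_mx intr b : 'rV[K]_n) (map_mx intr h) = (pair b h)%:~R.
Proof. by rewrite /pair -map_mxM mxE. Qed.

Lemma wt_intr (K : numFieldType) (S : kmDatum) (l : idx S -> int) :
  wt K l = map_mx intr (\sum_i l i *: alpha i).
Proof.
rewrite /wt raddf_sum; apply: eq_bigr => i _.
apply/matrixP => r c; by rewrite !mxE -intrM.
Qed.

(** If a were not pure, it would differ from every weight in a decomposition of x, and freeness of
    the simple roots makes all these differences nonzero. The eigenvector x would then fall into the
    radical. *)
Lemma kmRoot_pure (K : numFieldType) (S : kmDatum) (a : idx S -> int) :
  is_kmRoot K a -> pure a.
Proof.
case=> _ [x xr ax]; apply: contrapT => apure.
have [L dx pL] := weight_decomposition x.
pose diff (l : idx S -> int) := \sum_i (l i - a i) *: alpha i.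
have [|h hP] := @separating_vector _ [seq diff l | l <- L].
  rewrite all_map; elim: L pL {dx} => //= l L IH pL; rewrite IH; last first.
    by move=> l' l'L; apply: pL; right.
  rewrite andbT; apply/eqP => /(alpha_free (a := fun i => l i - a i)) la.
  have la' : l = a by apply/funext => i; apply/eqP; rewrite -subr_eq0 la.
  by apply: apure; rewrite -la'; apply: pL; left.
(* [kmRadical] is a union of ideals, so each h comes with its own J. One h that separates a from all
   the weights at once lets the argument run inside a single ideal. *)
apply: xr; have [J [idJ Jh Jx]] := ax (map_mx intr h).
exists J; split=> //; apply: eigenvector_in_ideal idJ dx _ Jx => l lL.
have : pair (diff l) h != 0.
  move: hP; rewrite all_map; elim: L lL {pL} => //= l' L IH.
  by case=> [->|lL] /andP[] // _; exact: IH.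
rewrite -/(wt K a) !wt_intr !pair_intr eqr_int; apply: contraNneq => e.
have -> : diff l = \sum_i l i *: alpha i - \sum_i a i *: alpha i.
  by rewrite -sumrB; apply: eq_bigr => i _; rewrite scalerBl.
by rewrite pairBl e subrr.
Qed.

(** * Simple transitivity of the Weyl group on chambers *)

Section WeylGroup.
Context (R : realType) (S : kmDatum).
Local Notation V := (V R S).
Local Notation refl i := (refl R i).
Local Notation al := (alphaK R).
Local Notation av := (alphavK R).
Implicit Types (i j k : idx S) (s t u x : seq (idx S)) (v y z : V).

Lemma pairDr (a : 'rV[R]_(rk S)) v (w : V) :
  pair a (v + w) = pair a v + pair a w.
Proof. by rewrite /pair mulmxDr mxE. Qed.

Lemma pairZr (a : 'rV[R]_(rk S)) c v : pair a (c *: v) = c * pair a v.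
Proof. by rewrite /pair -scalemxAr mxE. Qed.

Lemma pairNr (a : 'rV[R]_(rk S)) v : pair a (- v) = - pair a v.
Proof. by rewrite /pair mulmxN mxE. Qed.

Lemma pair0r (a : 'rV[R]_(rk S)) : pair a 0 = 0.
Proof. by rewrite /pair mulmx0 mxE. Qed.

Lemma pairBr (a : 'rV[R]_(rk S)) v (w : V) :
  pair a (v - w) = pair a v - pair a w.
Proof. by rewrite pairDr pairNr. Qed.

Lemma pair_root_coroot i j : pair (al i) (av j) = (cartan j i)%:~R.
Proof. by rewrite pair_intr pair_alpha. Qed.

Lemma reflE i v : refl i *m v = v - pair (al i) v *: av i.
Proof.
rewrite /Defs.refl mulmxBl mul1mx -mulmxA; congr (_ - _).
by apply/matrixP => r c; rewrite mxE big_ord1 [RHS]mxE mulrC (ord1 c).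
Qed.

Lemma refl_inv i : refl i *m refl i = 1%:M.
Proof.
rewrite /Defs.refl mulmxBl mul1mx mulmxBr mulmx1.
suff -> : av i *m al i *m (av i *m al i) = (2 : R) *: (av i *m al i).
  by rewrite scaler_nat mulr2n; apply/matrixP => r c; rewrite !mxE; ring.
rewrite mulmxA -(mulmxA (av i) (al i)).
suff -> : al i *m av i = 2%:M by rewrite mul_mx_scalar -scalemxAl.
apply/matrixP => r c; rewrite !ord1 [RHS]mxE eqxx mulr1n.
by have := pair_root_coroot i i; rewrite /pair cartan_diag.
Qed.

Definition word s : 'M[R]_(rk S) := foldr (fun i m => refl i *m m) 1%:M s.

Lemma word_cat s t : word (s ++ t) = word s *m word t.
Proof. by elim: s => [|i s IH] /=; rewrite ?mul1mx // IH mulmxA. Qed.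

Lemma word_ii i s : word (i :: i :: s) = word s.
Proof. by rewrite /= mulmxA refl_inv mul1mx. Qed.

Lemma weylP w : weyl w <-> exists s, w = word s.
Proof.
split=> [|[s ->]]; last by elim: s => [|i s IH]; constructor.
by elim=> [|i w' _ [s ->]]; [exists [::]|exists (i :: s)].
Qed.

Definition reduced s := forall t, word t = word s -> (size s <= size t)%N.
(** For a reduced s: multiplying by r_i on the left does not lower the length of [word s]. *)
Definition no_descent i s :=
  forall t, word t = word (i :: s) -> (size s <= size t)%N.

Lemma reduced_exists s : exists2 t, reduced t & word t = word s.
Proof.
have [n] := ubnP (size s); elim: n s => // n IH s sn.
have [sr|/existsNP[t /not_implyP[ts /negP]]] := pselect (reduced s).
  by exists s.
rewrite -ltnNge => lt; have [|t' rt' t't] := IH t; last first.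
  by exists t' => //; rewrite t't.
by rewrite -ltnS; exact: leq_trans lt sn.
Qed.

Fixpoint alt i j n : seq (idx S) := if n is n.+1 then i :: alt j i n else [::].

Lemma size_alt i j n : size (alt i j n) = n.
Proof. by elim: n i j => //= n IH i j; rewrite IH. Qed.

Lemma alt_prefix i j m n : (m <= n)%N -> exists t, alt i j n = alt i j m ++ t.
Proof.
elim: m n i j => [|m IH] [|n] i j //= mn; try by eexists.
by have [t ->] := IH n j i mn; exists t.
Qed.

(** Equal neighbouring letters cancel, so a word in two letters that has no such pair alternates. *)
Lemma dihedral_word i j u : all [pred k | (k == i) || (k == j)] u ->
  [\/ u = alt i j (size u), u = alt j i (size u) |
     exists2 t, word t = word u & (size t < size u)%N].
Proof.
elim: u => [|k u IH] /=; first by constructor 1.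
case/andP=> kij /IH[uE|uE|[t tu lt]].
- case/orP: kij => /eqP ->; last by constructor 2; congr cons.
  case: u uE {IH} => [|k' u] /=; first by constructor 1.
  by case=> -> _; constructor 3; exists u => //; exact/esym/word_ii.
- case/orP: kij => /eqP ->; first by constructor 1; congr cons.
  case: u uE {IH} => [|k' u] /=; first by constructor 2.
  by case=> -> _; constructor 3; exists u => //; exact/esym/word_ii.
- by constructor 3; exists (k :: t); rewrite /= ?tu.
Qed.

Lemma mulmx_ext (A B : 'M[R]_(rk S)) :
  (forall z, A *m z = B *m z) -> A = B.
Proof.
move=> AB; apply/matrixP => r c.
by have /colP/(_ r) := AB (delta_mx c 0); rewrite -!colE !mxE.
Qed.

Section RankTwo.
Variables (i j : idx S) (a b : R).
Hypotheses (ija : pair (al j) (av i) = - a) (ijb : pair (al i) (av j) = - b).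

Lemma root_refl_self k z : pair (al k) (refl k *m z) = - pair (al k) z.
Proof.
rewrite reflE pairBr pairZr pair_root_coroot cartan_diag.
by rewrite mulr_natr mulr2n; ring.
Qed.

Lemma root_i_refl_j z :
  pair (al i) (refl j *m z) = pair (al i) z + b * pair (al j) z.
Proof. by rewrite reflE pairBr pairZr ijb; ring. Qed.

Lemma root_j_refl_i z :
  pair (al j) (refl i *m z) = pair (al j) z + a * pair (al i) z.
Proof. by rewrite reflE pairBr pairZr ija; ring. Qed.

Let ii : pair (al i) (av i) = 2.
Proof. by rewrite pair_root_coroot cartan_diag. Qed.
Let jj : pair (al j) (av j) = 2.
Proof. by rewrite pair_root_coroot cartan_diag. Qed.

Lemma refl_i_comb z c d :
  refl i *m (z + c *: av i + d *: av j) =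
  z + (b * d - c - pair (al i) z) *: av i + d *: av j.
Proof.
rewrite reflE !pairDr !pairZr ii ijb.
by apply/matrixP => p q; rewrite !mxE; ring.
Qed.

Lemma refl_j_comb z c d :
  refl j *m (z + c *: av i + d *: av j) =
  z + c *: av i + (a * c - d - pair (al j) z) *: av j.
Proof.
rewrite reflE !pairDr !pairZr jj ija.
by apply/matrixP => p q; rewrite !mxE; ring.
Qed.

End RankTwo.

(* Applying r_j turns the form p alpha_i + q alpha_j into
   p alpha_i + (b p - q) alpha_j; b p >= 2 q and a b >= 4 then give the same
   inequality with i and j exchanged. *)
Lemma alt_infinite i j a b y (p q : R) n :
  pair (al j) (av i) = - a -> pair (al i) (av j) = - b ->
  0 < a -> 0 < b -> 4 <= a * b ->
  0 < pair (al i) y -> 0 < pair (al j) y -> 0 < p -> 0 <= q -> 2 * q <= b * p ->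
  0 < p * pair (al i) (word (alt j i n) *m y)
      + q * pair (al j) (word (alt j i n) *m y).
Proof.
elim: n i j a b p q => [|n IH] i j a b p q ija ijb a0 b0 ab yi yj p0 q0 qp /=.
  by rewrite mul1mx ltr_wpDr ?mulr_gt0 ?mulr_ge0 // ltW.
rewrite -mulmxA (root_i_refl_j ijb) root_refl_self.
set Z := word _ *m y; have -> : p * (pair (al i) Z + b * pair (al j) Z) +
  q * - pair (al j) Z = (b * p - q) * pair (al j) Z + p * pair (al i) Z by ring.
have bp : 0 < b * p by rewrite mulr_gt0.
apply: (IH _ _ b a) => //; rewrite ?(mulrC b a) //; try lra.
have : 4 * p <= a * b * p by rewrite ler_pM2r.
have : a * (2 * q) <= a * (b * p) by rewrite ler_pM2l.
by rewrite !mulrA; lra.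
Qed.

(** For n >= m, the braid relation replaces the first m letters by a block starting with i. The word
    is then i followed by n - 1 letters, against the minimality assumption, so only n < m is
    left. *)
Lemma alt_finite i j y m :
  word (alt j i m) = word (alt i j m) -> (0 < m)%N ->
  (forall n, (n < m)%N -> 0 < pair (al i) (word (alt j i n) *m y)) ->
  forall n, (forall t, word (i :: t) = word (alt j i n) -> (n <= size t)%N) ->
  0 < pair (al i) (word (alt j i n) *m y).
Proof.
move=> braid m0 ypos n nmin; have [/ypos //|mn] := ltnP n m.
have [t tE] := alt_prefix j i mn.
case: m m0 braid {ypos} mn tE => // m _ braid mn tE.
have := nmin (alt j i m ++ t); rewrite -cat_cons -[i :: _]/(alt i j m.+1).
rewrite word_cat -braid -word_cat -tE => /(_ erefl).
have := congr1 size tE; rewrite !size_cat !size_alt => ->.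
by rewrite addSn ltnn.
Qed.

(** With -p and -q the two Cartan integers, p q >= 4 is the infinite dihedral case; for p q < 4 a
    braid relation bounds n. *)
Lemma alt_positive i j y n : i != j ->
  0 < pair (al i) y -> 0 < pair (al j) y ->
  (forall t, word (i :: t) = word (alt j i n) -> (n <= size t)%N) ->
  0 < pair (al i) (word (alt j i n) *m y).
Proof.
move=> ij yi yj nmin.
have [p pE] : exists p : nat, cartan i j = - p%:Z.
  exists `|cartan i j|%N.
  by rewrite abszE ler0_norm ?opprK //; exact: cartan_offdiag.
have [q qE] : exists q : nat, cartan j i = - q%:Z.
  exists `|cartan j i|%N.
  by rewrite abszE ler0_norm ?opprK //; apply: cartan_offdiag; rewrite eq_sym.
have pq0 : (p == 0)%N = (q == 0)%N.
  apply/eqP/eqP => h.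
    have /cartan_zero : cartan i j = 0 by rewrite pE h.
    by rewrite qE => /eqP; rewrite oppr_eq0 => /eqP[].
  have /cartan_zero : cartan j i = 0 by rewrite qE h.
  by rewrite pE => /eqP; rewrite oppr_eq0 => /eqP[].
have ija : pair (al j) (av i) = - p%:R by rewrite pair_root_coroot pE mulrNz.
have ijb : pair (al i) (av j) = - q%:R by rewrite pair_root_coroot qE mulrNz.
have [pq|pq] := leqP 4 (p * q).
  have p0 : (0 < p)%N by case: (p) pq.
  have q0 : (0 < q)%N by case: (q) pq => //; rewrite muln0.
  rewrite -[X in 0 < X]mul1r -[X in 0 < X]addr0.
  rewrite -[X in _ + X](mul0r (pair (al j) (word (alt j i n) *m y))).
  apply: (alt_infinite n ija ijb); rewrite ?ltr0n ?mulr0 ?mulr1 //.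
  by rewrite -natrM ler_nat.
have step := (root_i_refl_j ijb, root_j_refl_i ija, root_refl_self).
have comb z : z = z + 0 *: av i + 0 *: av j by rewrite !scale0r !addr0.
have fin m : (0 < m)%N ->
    (forall z, word (alt j i m) *m z = word (alt i j m) *m z) ->
    (forall n, (n < m)%N -> 0 < pair (al i) (word (alt j i n) *m y)) ->
    0 < pair (al i) (word (alt j i n) *m y).
  by move=> m0 bm ym; apply: (alt_finite (m := m)) => //; exact: mulmx_ext.
have combs := (refl_i_comb ijb, refl_j_comb ija).
clear nmin; case: p q pq0 pq {pE qE} ija ijb step combs
  => [|[|[|[|p]]]] [|[|[|[|q]]]] //= _ _ ija ijb step combs.
(* The remaining pairs (p, q) are (0,0), (1,1), (1,2), (1,3), (2,1), (3,1), in this order. The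
   Coxeter exponent m satisfies 4 cos^2(pi/m) = p q. *)
all: [> apply: (fin 2) | apply: (fin 3) | apply: (fin 4) | apply: (fin 6)
  | apply: (fin 4) | apply: (fin 6)].
all: [> by [] | move=> z | | by [] | move=> z | | by [] | move=> z |
  | by [] | move=> z | | by [] | move=> z | | by [] | move=> z |].
all: try (rewrite /= !mulmx1 -!mulmxA (comb z) !combs;
  congr (_ + _ *: _ + _ *: _); ring).
(* Below the exponent, the value is an explicit nonnegative combination of alpha_i(y) and
   alpha_j(y), with a nonzero coefficient. *)
all: move=> [|[|[|[|[|[|k]]]]]] => [|||||| // ].
all: move=> lt; try by exfalso; exact: notF lt.
all: rewrite /= ?mulmx1 ?mul1mx -?mulmxA ?step; lra.
Qed.

(* Write s = u x with u in <r_i, r_j> and x of minimal length: induction makes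
   alpha_i and alpha_j positive on x C, which leaves the rank two word u. *)
Lemma weyl_positive s i v : reduced s -> no_descent i s -> Cvf v ->
  0 < pair (al i) (word s *m v).
Proof.
have [n] := ubnP (size s); elim: n s i => // n IH s i sn rs nis Cv.
case: s rs nis sn => [|j s] rs nis sn; first by rewrite mul1mx; exact: Cv.
have ji : j != i.
  apply/eqP => ji; have := nis s; rewrite ji word_ii => /(_ erefl).
  by rewrite /= ltnn.
pose J := [pred k | (k == i) || (k == j)].
pose good m := `[< exists u x, [/\ all J u, word (u ++ x) = word (j :: s),
  size (u ++ x) = size (j :: s) & size x = m] >].
have exg : exists m, good m.
  by exists (size s); apply/asboolP; exists [:: j], s; rewrite /= eqxx orbT.
case: (ex_minnP exg) => m /asboolP[u [x [uJ uxE uxs xm]]] mmin.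
have ms : (m <= size s)%N.
  by apply: mmin; apply/asboolP; exists [:: j], s; rewrite /= eqxx orbT.
have rx : reduced x.
  move=> t tx; have := rs (u ++ t); rewrite word_cat tx -word_cat => /(_ uxE).
  by rewrite -uxs !size_cat leq_add2l.
(* If r_k shortened x, moving the letter k to the end of u would give a shorter right factor,
   against the choice of m. *)
have ndx k : J k -> no_descent k x.
  move=> kJ t tE; rewrite leqNgt; apply/negP => tx.
  have E : word (rcons u k ++ t) = word (j :: s).
    by rewrite word_cat tE -word_cat cat_rcons word_cat word_ii -word_cat.
  have sz : size (rcons u k ++ t) = size (j :: s).
    apply/eqP; rewrite eqn_leq rs // andbT -uxs !size_cat size_rcons addSnnS.
    by rewrite leq_add2l.
  have : (m <= size t)%N.
    apply: mmin; apply/asboolP; exists (rcons u k), t.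
    by rewrite all_rcons kJ uJ.
  by rewrite -xm leqNgt tx.
have xn : (size x < n)%N by rewrite xm; exact: leq_ltn_trans ms sn.
have yi : 0 < pair (al i) (word x *m v).
  by apply: IH => //; apply: ndx; rewrite /= eqxx.
have yj : 0 < pair (al j) (word x *m v).
  by apply: IH => //; apply: ndx; rewrite /= eqxx orbT.
rewrite -uxE word_cat -mulmxA.
have umin t : word t = word u -> (size u <= size t)%N.
  move=> tu; have := rs (t ++ x); rewrite word_cat tu -word_cat => /(_ uxE).
  by rewrite -uxs !size_cat leq_add2r.
have uimin t : word (i :: t) = word u -> (size u <= size t)%N.
  move=> tu; have := nis (t ++ x); rewrite -uxs !size_cat leq_add2r; apply.
  rewrite -[RHS]/(refl i *m word (j :: s)) -uxE (word_cat u) -tu mulmxA.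
  by rewrite -[refl i *m word (i :: t)]/(word (i :: i :: t)) word_ii word_cat.
(* By [umin] the word u alternates, and by [uimin] it cannot start with i: it is empty or starts
   with j. *)
case: (dihedral_word uJ) => [uE|uE|[t /umin]]; last by case: leqP.
  case: (size u) uE uimin => [|k] uE uimin; first by rewrite uE mul1mx.
  have := uimin (alt j i k); rewrite uE => /(_ erefl).
  by rewrite /= !size_alt ltnn.
rewrite uE; apply: alt_positive => //; first by rewrite eq_sym.
by rewrite -uE.
Qed.

(** If a reduced word of w starts with i, then alpha_i is positive at the image of v under the rest
    of the word, hence negative at w v. *)
Lemma weyl_chamber_id (w : 'M[R]_(rk S)) v :
  weyl w -> Cvf v -> Cvf (w *m v) -> w = 1%:M.
Proof.
move=> /weylP[s0 ->]; have [s rs <-] := reduced_exists s0 => Cv.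
case: s rs => [//|i s] rs Cwv.
have rs' : reduced s.
  by move=> t ts; have := rs (i :: t); rewrite /= ts => /(_ erefl).
have nd : no_descent i s.
  by move=> t /rs /=; apply: leq_trans.
have := weyl_positive rs' nd Cv; have := Cwv i.
by rewrite /= -mulmxA root_refl_self oppr_gt0 => /ltW; case: ltP.
Qed.

End WeylGroup.

(** * The fundamental chamber *)

(** Multiplying a rational relation by d, the product of all denominators, gives an integral one. *)
Lemma int_free_row_free (I : finType) n (a : I -> 'rV[int]_n) :
  (forall c : I -> int, \sum_i c i *: a i = 0 -> forall i, c i = 0) ->
  row_free (\matrix_(k < #|I|, j < n) ((a (enum_val k) 0 j)%:~R : rat)).
Proof.
move=> afree; apply: inj_row_free => u uA.
pose d := \prod_k denq (u 0 k).
have d0 : d != 0 by apply/prodf_neq0 => k _; rewrite denq_eq0.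
pose c k : int := numq (u 0 k) * \prod_(l | l != k) denq (u 0 l).
have cE k : (c k)%:~R = d%:~R * u 0 k.
  rewrite /d (bigD1 k) //= /c !intrM numqE; ring.
have c0 : forall i, c (enum_rank i) = 0.
  apply: afree; apply/rowP => j; apply/eqP; rewrite -(eqr_int rat).
  have /rowP/(_ j) := uA; rewrite !mxE summxE.
  rewrite -[X in _ == X](mulr0 (d%:~R : rat)) => <-.
  rewrite rmorph_sum mulr_sumr /= (reindex (@enum_rank I)); last first.
    by apply: onW_bij; exact: enum_rank_bij.
  apply/eqP; apply: eq_bigr => i _.
  by rewrite !mxE intrM cE enum_rankK mulrA.
apply/rowP => k; rewrite mxE; apply/eqP.
have := c0 (enum_val k); rewrite enum_valK => /eqP.
by rewrite -(eqr_int rat) cE mulf_eq0 intr_eq0 (negbTE d0).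
Qed.

Section Chamber.
Context (R : realType) (S : kmDatum).
Local Notation V := (V R S).
Local Notation refl i := (refl R i).
Local Notation al := (alphaK R).
Local Notation av := (alphavK R).
Local Notation C := (@Cvf R S).
Implicit Types (i j k : idx S) (v c u x y : V) (w : 'M[R]_(rk S)).

(** Freeness of the simple roots gives a right inverse of their matrix over the rationals. Applied
    to the all-ones vector, it yields a point where every simple root takes the value 1. *)
Lemma chamber_nonempty : exists c, C c.
Proof.
have /row_freeP[B AB] := int_free_row_free (@alpha_free S).
exists (map_mx ratr (B *m const_mx 1)) => i.
have -> : al i = map_mx ratr (row (enum_rank i)
    (\matrix_(k < #|idx S|, j < rk S) ((alpha (enum_val k) 0 j)%:~R : rat))).
  by apply/rowP => j; rewrite !mxE enum_rankK ratr_int.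
rewrite /pair -map_mxM mulmxA -row_mul AB.
by rewrite -row_mul mul1mx !mxE rmorph1 ltr01.
Qed.

Lemma chamberD c u : C c -> (forall i, 0 <= pair (al i) u) -> C (c + u).
Proof. by move=> Cc Cu i; rewrite pairDr ltr_wpDr // Cc. Qed.

Lemma chamberZ (t : R) c : 0 < t -> C c -> C (t *: c).
Proof. by move=> t0 Cc i; rewrite pairZr mulr_gt0 // Cc. Qed.

(** This is what makes any two translates of the chamber contain a common third one. *)
Lemma chamber_absorbs c x : C c -> exists2 t : R, 0 < t & C (x + t *: c).
Proof.
move=> Cc; pose t := 1 + \sum_i `|pair (al i) x| / pair (al i) c.
have sum_ge0 : 0 <= \sum_i `|pair (al i) x| / pair (al i) c.
  by apply: sumr_ge0 => i _; rewrite divr_ge0 // ltW // Cc.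
exists t => [|i]; first by rewrite /t; lra.
rewrite pairDr pairZr; have Ci := Cc i.
have : `|pair (al i) x| / pair (al i) c < t.
  rewrite /t (bigD1 i) //= addrCA ltrDl ltr_pwDl //.
  by apply: sumr_ge0 => k _; rewrite divr_ge0 // ltW // Cc.
rewrite ltr_pdivrMr // => lt; have := ler_norm (- pair (al i) x).
by rewrite normrN; lra.
Qed.

Lemma pair_continuous (a : 'rV[R]_(rk S)) : continuous (pair a : V -> R).
Proof.
have -> : (pair a : V -> R) = fun v : V => \sum_j a 0 j * v j 0.
  by apply/funext => v; rewrite /pair mxE.
apply: continuous_big => [|j _ v]; first exact: add_continuous.
by apply: continuousM; [exact: cst_continuous|exact: coord_continuous].
Qed.

Lemma chamber_open : open C.
Proof.
rewrite openE => v Cv.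
apply: (@filter_forall V (idx S) (fun i u => 0 < pair (al i) u) (nbhs v)) => i.
have op : open [set u : V | 0 < pair (al i) u].
  apply: (@open_comp V R (pair (al i)) [set r | 0 < r]) => [u _|].
    exact: pair_continuous.
  exact: open_gt.
by apply: open_nbhs_nbhs; split=> //; exact: Cv.
Qed.

Lemma closure_chamberP u : closure C u <-> forall i, 0 <= pair (al i) u.
Proof.
split=> [clu i|u0].
  have : closed [set v : V | 0 <= pair (al i) v].
    apply: (@closed_comp V R (pair (al i)) [set r | 0 <= r]) => [v _|].
      exact: pair_continuous.
    exact: closed_ge.
  apply; apply: closureS clu => v /(_ i); exact: ltW.
have [c Cc] := chamber_nonempty.
move=> B uB.
have /= : (fun e : R => u + e *: c) x @[x --> 0] --> u + (0 : R) *: c.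
  by apply: cvgD; [exact: cvg_cst|apply: cvgZl; exact: cvg_id].
rewrite scale0r addr0 => /(_ _ uB) [e /= e0 eB].
exists (u + (e / 2) *: c); split.
  by rewrite addrC; apply: chamberD => //; apply: chamberZ => //; lra.
apply: eB; rewrite /ball /= sub0r normrN ger0_norm; lra.
Qed.

Lemma chamber_tits : C `<=` interior (@tits R S).
Proof.
apply: (@subset_trans _ (interior C)).
  by have /interior_id -> := chamber_open.
apply: interiorS => v Cv; exists 1%:M; first exact: weyl1.
by exists v; [exact: subset_closure|rewrite mul1mx].
Qed.

End Chamber.

(** * Affine Weyl group, sector-germs and enclosures *)

Section AffineWeylGroup.
Context (R : realType) (S : kmDatum).
Local Notation V := (V R S).
Local Notation refl i := (refl R i).
Local Notation al := (alphaK R).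
Local Notation av := (alphavK R).
Local Notation Mx := 'M[R]_(rk S).
Implicit Types (i j k : idx S) (v c u x y t : V) (w g : Mx).

Lemma weylM2 w w' : weyl w -> weyl w' -> weyl (w *m w').
Proof.
move=> /weylP[s ->] /weylP[s' ->]; apply/weylP.
by exists (s ++ s'); rewrite word_cat.
Qed.

Lemma weyl_refl i : weyl (refl i).
Proof. by rewrite -[refl i]mulmx1; constructor; constructor. Qed.

Lemma weyl_inverse w : weyl w ->
  [/\ w \in unitmx, weyl (invmx w), invmx w *m w = 1%:M & w *m invmx w = 1%:M].
Proof.
move=> ww; have [w' ww' w'w] : exists2 w', weyl w' & w' *m w = 1%:M.
  elim: ww => [|i u wu [u' wu' u'u]].
    by exists 1%:M; [constructor|rewrite mulmx1].
  exists (u' *m refl i); first by apply: weylM2 => //; exact: weyl_refl.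
  by rewrite -mulmxA (mulmxA (refl i)) refl_inv mul1mx.
have [_ uw] := mulmx1_unit w'w.
have e : invmx w = w' by rewrite -[LHS]mul1mx -w'w -mulmxA mulmxV // mulmx1.
by split; rewrite ?e // -?e ?mulVmx ?mulmxV.
Qed.

Definition coroot_lattice t :=
  exists c : idx S -> int, t = \sum_i (c i)%:~R *: av i.

Lemma coroot_latticeN t : coroot_lattice t -> coroot_lattice (- t).
Proof.
case=> c ->; exists (fun i => - c i); rewrite -sumrN.
by apply: eq_bigr => i _; rewrite mulrNz scaleNr.
Qed.

Lemma pair_sumr (a : 'rV[R]_(rk S)) (I : Type) (r : seq I) (F : I -> V) :
  pair a (\sum_(i <- r) F i) = \sum_(i <- r) pair a (F i).
Proof. by rewrite /pair mulmx_sumr summxE. Qed.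

Lemma pair_coroot_lattice i t :
  coroot_lattice t -> exists m : int, pair (al i) t = m%:~R.
Proof.
case=> c ->; exists (\sum_j c j * cartan j i).
rewrite pair_sumr rmorph_sum; apply: eq_bigr => j _.
by rewrite pairZr pair_root_coroot -intrM.
Qed.

Lemma weyl_coroot_lattice w t :
  weyl w -> coroot_lattice t -> coroot_lattice (w *m t).
Proof.
elim=> [|i u _ IH] ht; first by rewrite mul1mx.
rewrite -mulmxA reflE; have [m ->] := pair_coroot_lattice i (IH ht).
have [c ->] := IH ht; exists (fun j => c j - m * (j == i)%:R).
rewrite [RHS](bigD1 i) //= [in LHS](bigD1 i) //= eqxx mulr1 intrB scalerBl.
rewrite addrAC; congr (_ + _); apply: eq_bigr => j /negbTE ji.
by rewrite ji mulr0 subr0.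
Qed.

Definition wc_map g t (q : set V * V) : set V * V := (aff g t @` q.1, g *m q.2).

Lemma aff_comp g t g' t' : aff g t \o aff g' t' = aff (g *m g') (g *m t' + t).
Proof. by apply/funext => x; rewrite /aff /= mulmxDr mulmxA addrA. Qed.

Lemma wc_map_comp g t g' t' :
  wc_map g t \o wc_map g' t' = wc_map (g *m g') (g *m t' + t).
Proof.
apply/funext => -[P v]; rewrite /wc_map /=; congr (_, _); last first.
  by rewrite mulmxA.
by rewrite -aff_comp image_comp.
Qed.

Lemma wc_map1 : wc_map 1%:M 0 = id.
Proof.
apply/funext => -[P v]; rewrite /wc_map /= mul1mx; congr (_, _).
have -> : aff 1%:M 0 = @id V by apply/funext => x; rewrite /aff mul1mx addr0.
by rewrite image_id.
Qed.

Lemma aff_inv w t : weyl w ->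
  cancel (aff w t) (aff (invmx w) (- (invmx w *m t))) /\
  cancel (aff (invmx w) (- (invmx w *m t))) (aff w t).
Proof.
move=> /weyl_inverse[_ _ w1 w2]; split=> x; rewrite /aff.
  by rewrite mulmxDr mulmxA w1 mul1mx addrK.
by rewrite mulmxDr mulmxN !mulmxA w2 !mul1mx subrK.
Qed.

(** Roots take integral values on the coroot lattice, so a wall of level k goes to a wall of level k
    - m with m an integer. The inverse map has the same form, which gives the other inclusion. Thus
    Weyl isomorphisms are isomorphisms. *)
Lemma autA_coroot_lattice w t : weyl w -> coroot_lattice t -> autA w t.
Proof.
have sub w' t' : weyl w' -> coroot_lattice t' ->
    wc_map w' t' @` @wallCoroot R S `<=` @wallCoroot R S.
  move=> ww' ht' _ [_ [_ [k [[w0 [i [ww0 ->]]] ->]] <-]] /=.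
  have [uw' wiw' w1 w2] := weyl_inverse ww'.
  have [uw0 wiw0 w01 w02] := weyl_inverse ww0.
  have ww'w0 := weylM2 ww' ww0.
  have iw : invmx (w' *m w0) = invmx w0 *m invmx w'.
    have [_ _ _ W2] := weyl_inverse ww'w0.
    rewrite -[RHS]mulmx1 -W2 !mulmxA -(mulmxA _ (invmx w') w') w1 mulmx1.
    by rewrite w01 mul1mx.
  have [m mE] : exists m : int, pair (al i *m invmx (w' *m w0)) t' = m%:~R.
    rewrite /pair -mulmxA; apply: pair_coroot_lattice.
    by apply: weyl_coroot_lattice ht'; have [] := weyl_inverse ww'w0.
  exists (al i *m invmx (w' *m w0), w' *m w0 *m av i), (k - m); split.
    by exists (w' *m w0), i.
  rewrite /wc_map /= mulmxA; congr (_, _).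
  have E x :
      pair (al i *m invmx (w' *m w0)) (w' *m x) = pair (al i *m invmx w0) x.
    by rewrite /pair iw !mulmxA -(mulmxA _ (invmx w') w') w1 mulmx1.
  apply/seteqP; split=> [_ [x xw <-]|x xw].
    rewrite /wall /= /aff pairDr E mE intrB addrACA subrr addr0.
    exact: xw.
  exists (invmx w' *m (x - t')); last first.
    by rewrite /aff mulmxA w2 mul1mx subrK.
  rewrite /wall /= -E mulmxA w2 mul1mx pairBr mE.
  by rewrite -[RHS]xw intrB addrAC addrA.
move=> ww ht; split; first by have [] := weyl_inverse ww.
rewrite -[X in X @` _]/(wc_map w t).
apply/seteqP; split; first exact: sub.
have [uw wiw w1 w2] := weyl_inverse ww.
have ht' : coroot_lattice (- (invmx w *m t)).
  by apply: coroot_latticeN; exact: weyl_coroot_lattice.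
move=> q qW; exists (wc_map (invmx w) (- (invmx w *m t)) q).
  by apply: (sub _ _ wiw ht'); exists q.
rewrite -[LHS]/((wc_map w t \o wc_map (invmx w) _) q) wc_map_comp.
by rewrite mulmxN mulmxA w2 mul1mx addNr wc_map1.
Qed.

Lemma Wa_vwAut : @Wa R S `<=` @vwAut R S.
Proof.
move=> a [w [c [ww ->]]]; exists w, (\sum_i (c i)%:~R *: av i); split=> //.
by apply: autA_coroot_lattice => //; exists c.
Qed.

End AffineWeylGroup.

Section Sectors.
Context (R : realType) (S : kmDatum).
Local Notation V := (V R S).
Local Notation al := (alphaK R).
Local Notation C := (@Cvf R S).
Local Notation dominant u := (forall i, 0 <= pair (al i) u).
Implicit Types (i j : idx S) (v c u x y t : V) (w : 'M[R]_(rk S)).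

(** The factor [sgn R Plus], which is 1, is kept to match the germ in [is_splus] literally. *)
Definition germ_infty : set_system V :=
  sectorGerm 0 [set sgn R Plus *: v | v in C].

(** The base point x and the restriction of u to the closed chamber disappear, since any translate
    of w C contains one whose vertex is x + u for such a u. *)
Lemma sector_germP x w (E : set V) : weyl w ->
  sectorGerm x [set sgn R Plus *: (w *m v) | v in C] E <->
  exists y, forall c, C c -> E (w *m (y + c)).
Proof.
move=> ww; have [_ _ w1 w2] := weyl_inverse ww.
split=> [[u _ uE]|[y yE]].
  exists (invmx w *m (x + u)) => c Cc; rewrite mulmxDr mulmxA w2 mul1mx.
  apply: uE; exists (w *m c) => //; exists c => //=.
  by rewrite scale1r.
have [c Cc] := chamber_nonempty R S.
have [l l0 Cl] := chamber_absorbs (invmx w *m x - y) Cc.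
exists (w *m (l *: c)).
  apply: subset_closure; exists (l *: c); last by rewrite /= scale1r.
  exact: chamberZ.
move=> _ [_ [c' Cc' <-] <-] /=; rewrite scale1r.
have -> : x + w *m (l *: c) + w *m c' =
    w *m (y + (invmx w *m x - y + l *: c + c')).
  by rewrite !addrA (addrC y) addrK !mulmxDr mulmxA w2 mul1mx.
by apply/yE/chamberD => // i; exact/ltW/Cc'.
Qed.

Lemma germ_inftyP (E : set V) :
  germ_infty E <-> exists y, forall c, C c -> E (y + c).
Proof.
have w1 := weyl1 R S; rewrite /germ_infty.
have -> : [set sgn R Plus *: v | v in C] =
    [set sgn R Plus *: (1%:M *m v) | v in C].
  by apply/seteqP; split=> _ [v Cv <-]; exists v; rewrite ?mul1mx.
rewrite (sector_germP 0 E w1).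
by split=> -[y yE]; exists y => c /yE; rewrite mul1mx.
Qed.

Lemma germ_inftyI (E F : set V) :
  germ_infty E -> germ_infty F -> germ_infty (E `&` F).
Proof.
move=> /germ_inftyP[y yE] /germ_inftyP[z zF]; apply/germ_inftyP.
have [c Cc] := chamber_nonempty R S.
have [l l0 Cl] := chamber_absorbs (y - z) Cc.
exists (y + l *: c) => c' Cc'; split.
  rewrite -addrA; apply/yE/chamberD; first exact: chamberZ.
  by move=> i; exact/ltW/Cc'.
have -> : y + l *: c + c' = z + (y - z + l *: c + c').
  by rewrite !addrA (addrC z) addrK.
by apply/zF/chamberD => // i; exact/ltW/Cc'.
Qed.

Lemma germ_inftyS (E F : set V) : E `<=` F -> germ_infty E -> germ_infty F.
Proof.
by move=> EF /germ_inftyP[y yE]; apply/germ_inftyP; exists y => c /yE /EF.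
Qed.

Lemma germ_infty_nonempty E : germ_infty E -> E !=set0.
Proof.
have [c Cc] := chamber_nonempty R S.
by move=> /germ_inftyP[y yE]; exists (y + c); exact: yE.
Qed.

Lemma pair_suml (I : finType) (F : I -> 'rV[R]_(rk S)) v :
  pair (\sum_i F i) v = \sum_i pair (F i) v.
Proof. by rewrite /pair mulmx_suml summxE. Qed.

(** A root with nonpositive coefficients has a nonzero one, hence is strictly negative on the open
    chamber. Nonnegativity at c therefore forces nonnegative coefficients. *)
Lemma Delta_dominant (a : 'rV[R]_(rk S)) c u : Delta a -> C c ->
  0 <= pair a c -> dominant u -> 0 <= pair a u.
Proof.
move=> [l rl ->] Cc; have [[i0 li0] _] := rl; have := kmRoot_pure rl.
rewrite !pair_suml => -[l0 _ u0|l0 lc _].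
  by apply: sumr_ge0 => i _; rewrite pairZl mulr_ge0 ?u0 // ler0z.
suff : \sum_i pair ((l i)%:~R *: al i) c < 0 by rewrite ltNge lc.
rewrite (bigD1 i0) //= pairZl ltr_wnDr //.
  apply: sumr_le0 => i _; rewrite pairZl mulr_le0_ge0 ?lerz0 //.
  exact/ltW/Cc.
by rewrite nmulr_rlt0 ?Cc // ltrz0 lt_neqAle li0 l0.
Qed.

Lemma Delta_zero (a : 'rV[R]_(rk S)) v :
  Delta a -> (forall i, pair (al i) v = 0) -> pair a v = 0.
Proof.
move=> [l _ ->] v0; rewrite pair_suml big1 // => i _.
by rewrite pairZl v0 mulr0.
Qed.

Definition enclosed (k : Vdual R S -> option int) : set V :=
  \bigcap_(a in @Delta R S) D a (k a).

(** A half-line of direction u in the set forces a(u) >= 0 for every root a whose bound is finite,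
    hence a(v) >= 0 for every dominant v. *)
Lemma enclosedD k x u :
  (exists y, forall (t : R), 0 <= t -> enclosed k (y + t *: u)) ->
  C u -> enclosed k x -> forall v, dominant v -> enclosed k (x + v).
Proof.
move=> [y yk] Cu xk v v0 a aD; have := xk a aD.
have := fun (t : R) (t0 : 0 <= t) => yk t t0 a aD.
case: (k a) => // m; rewrite /D /= => ym xm.
rewrite pairDr addrAC addr_ge0 //; apply: (Delta_dominant aD Cu) => //.
rewrite leNgt; apply/negP => au.
have y0 : 0 <= pair a y + m%:~R by have := ym 0 (lexx _); rewrite scale0r addr0.
(* Chosen so that a(y + t u) + m equals -1. *)
pose t : R := - ((pair a y + m%:~R + 1) / pair a u).
have /ym : 0 <= t.
  rewrite /t -mulrN -invrN mulr_ge0 ?invr_ge0 ?oppr_ge0 ?(ltW au) //.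
  exact: addr_ge0.
rewrite pairDr pairZr /t mulNr mulfVK ?lt_eqF //; lra.
Qed.

Lemma enclosed_ray k y c : C c -> ray y (y + c) `<=` enclosed k ->
  forall x v, enclosed k x -> dominant v -> enclosed k (x + v).
Proof.
move=> Cc rk x v xk v0; apply: (enclosedD (u := c)) => //; exists y => t t0.
by apply: rk; exists t; rewrite // addrAC subrr add0r.
Qed.

Lemma enclosed_sector k : germ_infty (enclosed k) ->
  forall x v, enclosed k x -> dominant v -> enclosed k (x + v).
Proof.
move=> /germ_inftyP[y yk] x v; have [c Cc] := chamber_nonempty R S.
apply: (@enclosed_ray k (y + c) c) => // _ [t t0 <-].
rewrite [_ - (y + c)]addrAC subrr add0r -addrA; apply/yk/chamberD => // i.
by rewrite pairZr mulr_ge0 //; exact/ltW/Cc.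
Qed.

(** This is F^v(I), the common kernel of the simple roots, spelled with the sign and the Weyl
    element that [vface] expects. The face it defines at x plays the role of the point x. *)
Definition lineality : set V :=
  [set sgn R Plus *: (1%:M *m v) | v in Fv [set: idx S]%SET].
Definition chamber0 : set V :=
  [set sgn R Plus *: (1%:M *m v) | v in Fv (finset.set0 : {set idx S})].

Lemma linealityP v : lineality v <-> forall i, pair (al i) v = 0.
Proof.
split=> [[u u0 <-] i|v0].
  by have := u0 i; rewrite finset.in_setT mul1mx scale1r.
by exists v; rewrite ?mul1mx ?scale1r // => i; rewrite finset.in_setT.
Qed.

Lemma chamber0P v : chamber0 v <-> C v.
Proof.
split=> [[u u0 <-] i|Cv].
  by have := u0 i; rewrite finset.in_set0 mul1mx scale1r.
exists v; rewrite ?mul1mx ?scale1r // => i.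
by rewrite finset.in_set0; exact: Cv.
Qed.

Lemma vface_lineality : vface lineality.
Proof. by exists Plus, 1%:M, [set: idx S]%SET; split=> //; constructor. Qed.

Lemma vface_chamber0 : vface chamber0.
Proof. by exists Plus, 1%:M, finset.set0; split=> //; constructor. Qed.

Lemma titsInt_chamber c : C c -> titsInt Plus c.
Proof. by move=> Cc; exists c; [exact: chamber_tits|rewrite /= scale1r]. Qed.

Lemma splayed_chamber0 : splayed chamber0.
Proof.
have [c Cc] := chamber_nonempty R S.
by exists Plus, c; split; [exact/chamber0P|exact: titsInt_chamber].
Qed.

Lemma face_lineality_point x E : face x lineality E -> E x.
Proof.
move=> [k [k' [Om [Omx kE Omk]]]]; apply/kE/Omk; split.
  exact: nbhs_singleton.
by exists 0; rewrite ?addr0 //; apply/linealityP => i; rewrite pair0r.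
Qed.

(** Every root vanishes on the lineality space, so an enclosed set through x contains x +
    [lineality]. Taking all k' infinite makes the open conditions void. *)
Lemma face_lineality_enclosed x k :
  enclosed k x -> face x lineality (enclosed k).
Proof.
move=> xk; exists k, (fun=> None), setT; split; first exact: filterT.
  by move=> v vk a aD; have [] := vk a aD.
move=> _ [_ [v /linealityP v0 <-]] a aD; split=> //.
have := xk a aD; case: (k a) => // m.
by rewrite /D /= pairDr (Delta_zero aD v0) addr0.
Qed.

Lemma chimneyGerm_infty x E :
  chimneyGerm (face x lineality) chamber0 E -> germ_infty E.
Proof.
move=> [u _ [k [Z Zu Zk] kE]]; apply/germ_inftyP; exists (x + u) => c Cc.
apply/kE/Zk; exists (x + u); first exact: (face_lineality_point Zu).
by exists c => //; exact/chamber0P.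
Qed.

(** The ray makes the set stable under dominant translations, so it already contains an untranslated
    chimney based at y. *)
Lemma enclosed_chimneyGerm y c k : C c -> ray y (y + c) `<=` enclosed k ->
  chimneyGerm (face y lineality) chamber0 (enclosed k).
Proof.
move=> Cc yk; exists 0.
  have <- : C = chamber0 by apply/seteqP; split=> v /chamber0P.
  by apply/closure_chamberP => i; rewrite pair0r.
exists k => //; exists (enclosed k).
  have ky : enclosed k y.
    by apply: yk; exists 0; rewrite /= ?lexx // scale0r addr0.
  rewrite /translFilter /fmap /=.
  have -> : (fun v : V => v + 0) @^-1` enclosed k = enclosed k.
    by apply/seteqP; split=> v /=; rewrite addr0.
  exact: face_lineality_enclosed.
move=> _ [z zk [d /chamber0P Cd <-]].
by apply: (enclosed_ray Cc yk) => // i; exact/ltW/Cd.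
Qed.

End Sectors.

(** * Charts at a sector-germ *)

Section MasureSectors.
Context (R : realType) (S : kmDatum) (M : aptSystem R S).
Hypothesis masureM : is_masure M.
Local Notation V := (V R S).
Local Notation al := (alphaK R).
Local Notation C := (@Cvf R S).
Local Notation dominant u := (forall i, 0 <= pair (al i) u).
Local Notation germ_infty := (@germ_infty R S).
Implicit Types (A B : set M) (psi f : V -> M) (v c u x y : V) (p q : M).

Lemma isomw_inj A f : apt A -> isomw A f -> injective f.
Proof. by move=> aA fA; have [] := MA1_bij masureM aA fA. Qed.

Lemma isomw_in A f v : apt A -> isomw A f -> A (f v).
Proof. by move=> aA fA; have [_ <-] := MA1_bij masureM aA fA; exists v. Qed.

Lemma isomw_surj A f p : apt A -> isomw A f -> A p -> exists v, f v = p.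
Proof.
by move=> aA fA; have [_ <-] := MA1_bij masureM aA fA; case=> v _ <-; exists v.
Qed.

Lemma isomw_modelIsom A psi : apt A -> isomw A psi -> modelIsom A psi.
Proof.
move=> aA psiA f fA; have [a aW ->] := (MA1_orbit masureM psi aA fA).1 psiA.
by exists a; first exact: Wa_vwAut.
Qed.

Lemma weylIsom_isom A B phi : weylIsom A B phi -> isom A B phi.
Proof.
move=> wphi f f' fA fB; have [a aW e] := wphi f f' fA fB.
by exists a; first exact: Wa_vwAut.
Qed.

Lemma weylIsom_comp A B f phi : apt B -> isomw A f -> weylIsom A B phi ->
  isomw B (phi \o f).
Proof.
move=> aB fA wphi; have [f' fB] := MA1_nonempty masureM aB.
apply/(MA1_orbit masureM _ aB fB); have [a aW e] := wphi f f' fA fB.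
by exists a => //; apply/funext => v; exact: e.
Qed.

Lemma contains_germ B psi : contains B (fmap psi germ_infty) ->
  exists y, forall c, C c -> B (psi (y + c)).
Proof. by move=> [E /germ_inftyP[y yE] EB]; exists y => c /yE /EB. Qed.

Lemma fmap_germ_eq psi psi' y : (forall c, C c -> psi (y + c) = psi' (y + c)) ->
  fmap psi germ_infty = fmap psi' germ_infty.
Proof.
have sub f g : (forall c, C c -> f (y + c) = g (y + c)) ->
    fmap f germ_infty `<=` fmap g germ_infty.
  move=> fg E Ef; have yC : germ_infty [set y + c | c in C].
    by apply/germ_inftyP; exists y => c Cc; exists c.
  apply: germ_inftyS (germ_inftyI Ef yC) => x [fE [c Cc e]].
  by move: fE; rewrite -e /= fg.
by move=> e; apply/seteqP; split; apply: sub => c Cc; rewrite e.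
Qed.

Lemma sectorGerm_chart s : sectorGermIn Plus s ->
  exists A psi, [/\ apt A, isomw A psi & s = fmap psi germ_infty].
Proof.
move=> [A [f [x [_ [aA fA [w ww ->] ->]]]]].
exists A, (f \o aff w 0); split=> //.
  apply/(MA1_orbit masureM _ aA fA); exists (aff w 0) => //.
  exists w, (fun=> 0); split=> //; rewrite big1 // => i _.
  by rewrite scale0r.
apply/funext => E; apply/propext; rewrite /fmap /=.
rewrite (sector_germP x _ ww) germ_inftyP.
by split=> -[y yE]; exists y => c Cc; have := yE c Cc; rewrite /= /aff addr0.
Qed.

Section Germ.
Variable s : set_system M.

Definition germ_chart A psi :=
  [/\ apt A, isomw A psi & fmap psi germ_infty = s].

(* A generic ray inside the sector forces the enclosed set it generates, which
   contains a subsector, to lie in B. *)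
Lemma germ_enclosed A B psi : germ_chart A psi -> apt B -> contains B s ->
  exists y c, [/\ C c, ma2Config A B psi (principal (ray y (y + c))) &
    exists2 k, ray y (y + c) `<=` enclosed k &
      forall x, enclosed k x -> B (psi x)].
Proof.
move=> [aA psiA <-] aB /contains_germ[y0 y0B].
have [c Cc] := chamber_nonempty R S; pose y := y0 + c; exists y, c.
have conf : ma2Config A B psi (principal (ray y (y + c))).
  split=> //.
    have [c0|c0] := eqVneq c 0.
      (* the ray is a point, which can only happen when I is empty *)
      suff -> : ray y (y + c) = [set y] by exact: ma2_point.
      rewrite c0 addr0; apply/seteqP; split=> [_ [t _ <-]|_ ->].
        by rewrite subrr scaler0 addr0.
      by exists 0; rewrite /= ?lexx // scale0r addr0.
    apply: (@ma2_ray _ _ y (y + c) Plus).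
      by move=> e; move/eqP: c0; apply; apply: (addrI y); rewrite addr0.
    by rewrite addrAC subrr add0r; exact: titsInt_chamber.
  exists (psi @` ray y (y + c)).
    by move=> v yv; exists v.
  move=> _ [_ [t t0 <-] <-]; rewrite [y + c - y]addrAC subrr add0r /y -addrA.
  apply/y0B/chamberD => // i; rewrite pairZr mulr_ge0 //.
  exact/ltW/Cc.
split=> //; have [[E [k rk kE] EAB] _] := MA2 masureM conf.
exists k => //.
by move=> x /kE /EAB[].
Qed.

(** (MA2) for a generic ray in the sector fixes the enclosure of the ray, which contains y + C and
    hence an element of s. *)
Lemma germ_transfer A B psi : germ_chart A psi -> apt B -> contains B s ->
  exists phi, [/\ weylIsom A B phi, germ_chart B (phi \o psi) & fixes phi s].
Proof.
move=> ch aB Bs; have [y [c [Cc conf [k0 yk0 kB]]]] := germ_enclosed ch aB Bs.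
have [aA psiA sE] := ch.
have [_ [phi wphi [E [k rk kE] Efix]]] := MA2 masureM conf.
have fix_y d : C d -> phi (psi (y + d)) = psi (y + d).
  move=> Cd; apply/Efix/kE/(enclosed_ray Cc rk) => [|i]; last exact/ltW/Cd.
  by apply: rk; exists 0; rewrite /= ?lexx // scale0r addr0.
exists phi; split=> //.
  split=> //; first exact: weylIsom_comp wphi.
  by rewrite -sE; apply: fmap_germ_eq fix_y.
exists (psi @` [set y + d | d in C]); last first.
  by move=> _ [_ [d Cd <-] <-]; exact: fix_y.
rewrite -sE; apply/germ_inftyP; exists y => d Cd.
by exists (y + d) => //; exists d.
Qed.

Hypothesis s_germ : sectorGermIn Plus s.

Lemma germ_chart_exists B : apt B -> contains B s ->
  exists psi, germ_chart B psi.
Proof.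
move=> aB Bs; have [A [psi [aA psiA sE]]] := sectorGerm_chart s_germ.
have [|phi [_ ch _]] := @germ_transfer A B psi _ aB Bs; first by split.
by exists (phi \o psi).
Qed.

Lemma germI (E F : set M) : s E -> s F -> (E `&` F) !=set0.
Proof.
have [A [psi [_ _ ->]]] := sectorGerm_chart s_germ => Es Fs.
by have [v [? ?]] := germ_infty_nonempty (germ_inftyI Es Fs); exists (psi v).
Qed.

(** (MA3) is applied to the face of direction F^v(I) at p. It gives the germ of a chimney of
    direction C^v_f, and elements of that germ contain subsectors of s. *)
Lemma apt_point_germ p : exists A, [/\ apt A, A p & contains A s].
Proof.
have [A [f [aA fA sE]]] := sectorGerm_chart s_germ.
have [B aB Bp] := masure_cover masureM p.
have [g gB] := MA1_nonempty masureM aB.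
have [x gx] := isomw_surj aB gB Bp.
pose L := @lineality R S; pose C0 := @chamber0 R S.
have fL z : is_face (face z L).
  by exists z; exists L => //; exact: vface_lineality.
have [||A' aA' [[E QE EA'] [F FF FA']]] := MA3 masureM
    (Q := fmap f (chimneyGerm (face 0 L) C0)) (F := fmap g (face x L)).
- exists A, f, (face 0 L), C0; split=> //; split=> //.
    exact: vface_chamber0.
  exact: splayed_chamber0.
- by left; exists B, g, (face x L).
exists A'; split=> //.
  by rewrite -gx; exact: FA' _ (face_lineality_point FF).
by exists E => //; rewrite sE; exact: chimneyGerm_infty QE.
Qed.

Lemma germ_chart_common A B psi v : germ_chart A psi -> apt B ->
  contains B s -> B (psi v) ->
  exists2 psi', germ_chart B psi' &
    forall u, dominant u -> psi' (v + u) = psi (v + u).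
Proof.
move=> ch aB Bs Bv; have [aA psiA sE] := ch.
have [y [c [Cc _ [k0 yk0 k0B]]]] := germ_enclosed ch aB Bs.
pose L := @lineality R S; pose C0 := @chamber0 R S.
have fL z : is_face (face z L).
  by exists z; exists L => //; exact: vface_lineality.
pose Q := fmap psi (chimneyGerm (face y L) C0).
pose F := fmap psi (face v L).
have Qk0 : Q (psi @` enclosed k0).
  have := enclosed_chimneyGerm Cc yk0; rewrite -/L -/C0 => -[u u0 [k ku kk0]].
  by exists u => //; exists k => // x /kk0 xk0; exists x.
have Fk k : enclosed k v -> F (psi @` enclosed k).
  move/face_lineality_enclosed => [k1 [k2 [Om [Omv kk vOm]]]].
  by exists k1, k2, Om; split=> // x /kk xk; exists x.
have conf : ma4Config A B psi Q F.
  split=> //; split.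
  - exists A, psi, (face y L), C0; split=> //; split=> //.
      exact: vface_chamber0.
    exact: splayed_chamber0.
  - by left; exists A, psi, (face v L).
  - split.
      exists (psi @` enclosed k0) => // _ [x _ <-]; exact: (isomw_in _ aA psiA).
    exists (psi @` enclosed (fun=> None)); first exact: Fk.
    by move=> _ [x _ <-]; exact: (isomw_in _ aA psiA).
  - split.
      by exists (psi @` enclosed k0) => // _ [x xk <-]; exact: k0B.
    (* B is only known to contain the point; (MA2) for a point puts an enclosed set through v, an
       element of the face, into B. *)
    have pconf : ma2Config A B psi (principal [set v]).
      split=> //; first exact: ma2_point.
      by exists [set psi v] => [|_ ->]; [move=> _ ->|].
    have [[E [k vk kE] EAB] _] := MA2 masureM pconf.
    exists (psi @` enclosed k); first by apply: Fk; exact: vk.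
    by move=> _ [x /kE /EAB[_ ?] <-].
have [phi wphi [E [k [Q' [F' [QQ' FF' kE]]] kE'] Efix]] := MA4 masureM conf.
have inj := isomw_inj aA psiA.
(* The enclosed set fixed by (MA4) contains F' and Q', hence v and a subsector, and so is stable
   under dominant translations. *)
have kv : enclosed k v.
  have [x xk /inj <- //] : (psi @` enclosed k) (psi v).
  by rewrite [_ @` _]kE; right; exact: (face_lineality_point FF').
have kg : germ_infty (enclosed k).
  have := chimneyGerm_infty QQ'; apply: germ_inftyS => x Qx.
  have [z zk /inj <- //] : (psi @` enclosed k) (psi x).
  by rewrite [_ @` _]kE; left.
have fix_k x : enclosed k x -> phi (psi x) = psi x by move=> /kE' /Efix.
exists (phi \o psi); last first.
  by move=> u u0; apply/fix_k/(enclosed_sector kg).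
split=> //; first exact: weylIsom_comp wphi.
have [z zk] := (germ_inftyP _).1 kg.
by rewrite -sE; apply: (fmap_germ_eq (y := z)) => d /zk /fix_k.
Qed.

(** Stated for [modelIsom], as [is_splus] allows charts whose translation part is outside the coroot
    lattice. *)
Lemma germ_chart_translation A psi psi' : apt A ->
  modelIsom A psi -> modelIsom A psi' ->
  fmap psi germ_infty = s -> fmap psi' germ_infty = s ->
  exists t, forall v, psi' v = psi (v + t).
Proof.
move=> aA mpsi mpsi' psis psis'; have [f fA] := MA1_nonempty masureM aA.
have [a [w [t [ww _ aE]]] psiE] := mpsi f fA.
have [a' [w' [t' [ww' _ aE']]] psiE'] := mpsi' f fA.
have [uw wiw w1 w2] := weyl_inverse ww.
pose b := invmx w *m w'; pose t0 := invmx w *m (t' - t).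
have psib v : psi' v = psi (b *m v + t0).
  rewrite psiE' psiE aE aE' /aff /b /t0 mulmxDr !mulmxA w2 !mul1mx.
  by rewrite addrA addrNK.
have wb : weyl b by exact: weylM2.
suff b1 : b = 1%:M by exists t0 => v; rewrite psib b1 mul1mx.
have inj : injective psi.
  move=> x x'; rewrite !psiE aE => /(isomw_inj aA fA).
  by have [/can_inj ai _] := aff_inv t ww; move/ai.
(* Equality of the germs puts a subsector y + C inside b C + t0. Far enough in it, b d = y - t0 + l
   c lies in C together with d. *)
have [y yb] : exists y, forall c, C c -> exists2 d, C d & y + c = b *m d + t0.
  have : fmap psi germ_infty [set psi (b *m d + t0) | d in C].
    rewrite psis -psis'; apply/germ_inftyP; exists 0 => d Cd /=.
    by rewrite add0r psib; exists d.
  move=> /germ_inftyP[y yE]; exists y => c /yE[d Cd /inj e].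
  by exists d.
have [c Cc] := chamber_nonempty R S.
have [l l0 Cl] := chamber_absorbs (y - t0) Cc.
have [d Cd e] := yb _ (chamberZ l0 Cc).
by apply: (weyl_chamber_id wb Cd); have -> : b *m d = y - t0 + l *: c;
  rewrite // addrAC e addrK.
Qed.

(** [splus] chooses a value, so uniqueness must be shown. A chart of A and a chart of B that agree
    on p plus the closed chamber link the two computations, and each given chart is a translate of
    one of them. *)
Lemma splusE A psi v u : apt A -> contains A s -> modelIsom A psi ->
  fmap psi germ_infty = s -> dominant u ->
  splus Plus s (psi v) u = psi (v + u).
Proof.
move=> aA As mpsi psis u0; apply: (@xget_unique {classic M}).
  exists A, psi; split=> //; last by split=> //; exists v; rewrite //= scale1r.
  have [f fA] := MA1_nonempty masureM aA; have [a _ ->] := mpsi f fA.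
  exact: (isomw_in _ aA fA).
move=> q [B [psi2 [aB Bp Bs mpsi2 [psi2s [v2 v2p ->]]]]]; rewrite scale1r.
have [chi [_ chiA chis]] := germ_chart_exists aA As.
have [t tE] :=
  germ_chart_translation aA (isomw_modelIsom aA chiA) mpsi chis psis.
have Bchi : B (chi (v + t)) by rewrite -tE.
have [//|chi' [_ chiB chi's] chiE] :=
  @germ_chart_common A B chi (v + t) _ aB Bs Bchi.
have [t2 t2E] :=
  germ_chart_translation aB (isomw_modelIsom aB chiB) mpsi2 chi's psi2s.
have e : v2 + t2 = v + t.
  apply: (isomw_inj aB chiB); rewrite -t2E v2p tE.
  by have := chiE 0; rewrite addr0 => -> // i; rewrite pair0r.
by rewrite t2E tE addrAC e [in RHS]addrAC chiE.
Qed.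

End Germ.
End MasureSectors.

(** * The norm expressing d_theta in coordinates *)

Section DominantNorm.
Context (R : realType) (S : kmDatum) (N : V R S -> R).
Hypothesis Nnorm : is_norm N.
Local Notation V := (V R S).
Local Notation al := (alphaK R).
Local Notation dominant u := (forall i, 0 <= pair (al i) u).
Implicit Types (x y z u : V).

Lemma norm0 : N 0 = 0.
Proof. by have [_ NZ _] := Nnorm; rewrite -(scale0r 0) NZ normr0 mul0r. Qed.

Lemma normN x : N (- x) = N x.
Proof. by have [_ NZ _] := Nnorm; rewrite -scaleN1r NZ normrN1 mul1r. Qed.

Lemma norm_ge0 x : 0 <= N x.
Proof.
have [ND _ _] := Nnorm; have := ND x (- x).
by rewrite subrr norm0 normN; lra.
Qed.

Definition dominant_costs z : set R :=
  [set N uu.1 + N uu.2 | uu in [set uu : V * V |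
    [/\ dominant uu.1, dominant uu.2 & z + uu.1 = uu.2]]].

Definition dominant_norm z : R := inf (dominant_costs z).

Lemma dominant_norm_le z r : dominant_costs z r -> dominant_norm z <= r.
Proof.
move=> zr; apply: ge_inf zr; exists 0 => _ [uu _ <-].
by rewrite addr_ge0 // norm_ge0.
Qed.

Lemma dominant_norm_ge z r :
  (forall r', dominant_costs z r' -> r <= r') -> r <= dominant_norm z.
Proof.
move=> rz; apply: lb_le_inf => //.
have [c Cc] := chamber_nonempty R S; have [l l0 Cl] := chamber_absorbs z Cc.
exists (N (l *: c) + N (z + l *: c)), (l *: c, z + l *: c) => //=.
by split=> // i; apply: ltW; [exact: (chamberZ l0 Cc)|exact: Cl].
Qed.

Lemma dominant_normD x y :
  dominant_norm (x + y) <= dominant_norm x + dominant_norm y.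
Proof.
have [ND _ _] := Nnorm.
rewrite -lerBlDr; apply: dominant_norm_ge => _ [[u u'] /= [u0 u'0 e] <-].
rewrite lerBlDr -lerBlDl.
apply: dominant_norm_ge => _ [[v v'] /= [v0 v'0 e'] <-].
rewrite lerBlDl; apply: (@le_trans _ _ (N (u + v) + N (u' + v'))); last first.
  by have := ND u v; have := ND u' v'; lra.
apply: dominant_norm_le; exists (u + v, u' + v') => //=; split.
- by move=> i; rewrite pairDr addr_ge0.
- by move=> i; rewrite pairDr addr_ge0.
- by rewrite addrACA e e'.
Qed.

Lemma dominant_normN z : dominant_norm (- z) = dominant_norm z.
Proof.
rewrite /dominant_norm; congr inf.
have sub x : dominant_costs (- x) `<=` dominant_costs x.
  move=> _ [[u u'] /= [u0 u'0 e] <-]; exists (u', u); last by rewrite addrC.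
  by split=> //=; rewrite -e addNKr.
by apply/seteqP; split; [exact: sub|rewrite -{1}(opprK z); exact: sub].
Qed.

Lemma dominant_norm0 : dominant_norm 0 = 0.
Proof.
apply/eqP; rewrite eq_le; apply/andP; split; last first.
  apply: dominant_norm_ge => _ [uu _ <-].
  by rewrite addr_ge0 // norm_ge0.
apply: dominant_norm_le; exists (0, 0); rewrite /= ?norm0 ?addr0 //.
by split=> // i; rewrite pair0r.
Qed.

Lemma dominant_norm_is_norm : is_norm dominant_norm.
Proof.
have [ND NZ N0] := Nnorm.
have scale_le (t : R) z :
    0 < t -> dominant_norm (t *: z) <= t * dominant_norm z.
  move=> t0; rewrite -ler_pdivrMl //.
  apply: dominant_norm_ge => _ [[u u'] /= [u0 u'0 e] <-].
  rewrite ler_pdivrMl //; apply: dominant_norm_le.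
  exists (t *: u, t *: u') => /=.
    split=> [i|i|]; rewrite -?scalerDr ?e // pairZr mulr_ge0 //; exact: ltW.
  by rewrite !NZ gtr0_norm // mulrDr.
have scale_pos (t : R) z :
    0 < t -> dominant_norm (t *: z) = t * dominant_norm z.
  move=> t0; apply/eqP; rewrite eq_le scale_le //=.
  have := @scale_le t^-1 (t *: z); rewrite invr_gt0 scalerA mulVf ?gt_eqF //.
  by rewrite scale1r ler_pdivlMl //; apply.
split; first exact: dominant_normD.
- move=> t z; have [t0|t0|->] := ltgtP t 0.
  + rewrite -dominant_normN -scaleNr scale_pos ?oppr_gt0 //.
    by rewrite ltr0_norm.
  + by rewrite scale_pos // gtr0_norm.
  + by rewrite scale0r dominant_norm0 normr0 mul0r.
(* From z = u' - u follows N z <= N u + N u', so the new norm dominates N. *)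
- move=> z z0; apply: N0; apply/eqP; rewrite eq_le norm_ge0 andbT -z0.
  apply: dominant_norm_ge => _ [[u u'] /= [_ _ e] <-].
  have -> : z = u' - u by rewrite -e addrK.
  by rewrite addrC -(normN u).
Qed.

End DominantNorm.

Theorem lemma26 (R : realType) (S : kmDatum) (M : aptSystem R S)
  (masureM : is_masure M) (thickM : thick M)
  (G : groupType) (act : G -> M -> M) (act_st : strongly_transitive act)
  (A0 : set M) (f0 : V R S -> M) (A0_apt : apt A0) (f0_A0 : isomw A0 f0)
  (stabA0 : inducedStab act A0 f0 = @WvY R S)
  (N : V R S -> R) (s : set_system M) (theta : Theta Plus N s)
  (A B : set M) (A_apt : apt A) (B_apt : apt B)
  (A_s : contains A s) (B_s : contains B s)
  (rho : M -> M) (rhoP : retraction A s rho)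
  (phi : M -> M) (phi_isom : isom A B phi)
  (phi_fix : forall p, (A `&` B) p -> phi p = p) :
  [/\ inducedByNorm A (dist Plus N s),
      forall (p : M) (u : V R S), closure (@Cvf R S) u ->
        rho (splus Plus s p u) = splus Plus s (rho p) u,
      forall p q : M,
        dist Plus N s (rho p) (rho q) <= dist Plus N s p q &
      forall p q : M, A p -> A q ->
        dist Plus N s (phi p) (phi q) = dist Plus N s p q].
Proof.
have [Nnorm s_germ] := theta.
(* In a chart at s, the condition defining [U] reads x + u = y + u', that is (x - y) + u = u'. *)
have distE D psi x y : apt D -> contains D s -> modelIsom D psi ->
    fmap psi (@germ_infty R S) = s ->
    dist Plus N s (psi x) (psi y) = dominant_norm N (x - y).
  move=> aD Ds mpsi psis.
  have [chi [_ chiD chis]] := germ_chart_exists masureM s_germ aD Ds.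
  have [t tE] := germ_chart_translation masureM aD
    (isomw_modelIsom masureM aD chiD) mpsi chis psis.
  have inj : injective psi.
    by move=> v v'; rewrite !tE => /(isomw_inj masureM aD chiD)/addIr.
  congr inf; congr image; apply/seteqP; split=> -[u u'] /=.
    move=> [/closure_chamberP u0 /closure_chamberP u'0].
    rewrite !(splusE masureM s_germ _ aD Ds mpsi psis) // => /inj e.
    by split=> //=; rewrite addrAC e addrAC subrr add0r.
  move=> [u0 u'0 e]; split; [exact/closure_chamberP|exact/closure_chamberP|].
  rewrite /= !(splusE masureM s_germ _ aD Ds mpsi psis) //.
  by rewrite -e addrA addrCA subrr addr0.
have [psi [_ psiA psis]] := germ_chart_exists masureM s_germ A_apt A_s.
have mpsi := isomw_modelIsom masureM A_apt psiA.
(* Between these two charts, rho is the identity in coordinates. *)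
have rho_chart p : exists D chi chi' v,
    [/\ germ_chart s D chi, contains D s, germ_chart s A chi', chi v = p &
      forall x, rho (chi x) = chi' x].
  have [D [aD Dp Ds]] := apt_point_germ masureM s_germ p.
  have [chi ch] := germ_chart_exists masureM s_germ aD Ds.
  have [rh [wrh chA fixrh]] := germ_transfer masureM ch A_apt A_s.
  have [_ chiD _] := ch; have [v vp] := isomw_surj masureM aD chiD Dp.
  exists D, chi, (rh \o chi), v; split=> // x.
  apply: (rhoP (chi x) D) => //; first exact: (isomw_in masureM _ aD chiD).
  exact: weylIsom_isom.
have rho_splus p u : closure (@Cvf R S) u ->
    rho (splus Plus s p u) = splus Plus s (rho p) u.
  move=> /closure_chamberP u0.
  have [D [chi [chi' [v [[aD chiD chis] Ds [_ chiA chi's] <- rhoE]]]]] :=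
    rho_chart p.
  rewrite rhoE (splusE masureM s_germ _ aD Ds) //; last first.
    exact: isomw_modelIsom.
  rewrite rhoE (splusE masureM s_germ _ A_apt A_s) //.
  exact: isomw_modelIsom.
split=> //.
- move=> f fA; have [a [w [c [ww ->]]] ->] :=
    (MA1_orbit masureM f A_apt psiA).1 fA.
  have [ND NZ N0] := dominant_norm_is_norm Nnorm.
  have [_ _ w1 _] := weyl_inverse ww.
  exists (fun z => dominant_norm N (w *m z)); last first.
    move=> x y; rewrite (distE A psi) // /aff; congr (dominant_norm _ _).
    by rewrite mulmxBr opprD addrACA subrr addr0.
  split=> [x y|t x|x /N0 wx].
  + by rewrite mulmxDr.
  + by rewrite -scalemxAr.
  + by rewrite -[x]mul1mx -w1 -mulmxA wx mulmx0.
- move=> p q.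
  (* [U] must be nonempty before the infima can be compared: the points r +_s u with u in C form an
     element of s, and two elements of s meet. *)
  have [u [u' [u0 u'0 e]]] : exists u u', [/\ closure (@Cvf R S) u,
      closure (@Cvf R S) u' & splus Plus s p u = splus Plus s q u'].
    have shift r : s [set x | exists2 u, Cvf u & x = splus Plus s r u].
      have [D [chi [_ [v [[aD chiD chis] Ds _ <- _]]]]] := rho_chart r.
      rewrite -{1}chis; apply/germ_inftyP; exists v => c Cc; exists c => //.
      rewrite (splusE masureM s_germ _ aD Ds) //; first exact: isomw_modelIsom.
      by move=> i; exact/ltW/Cc.
    have [x [[u Cu xu] [u' Cu' xu']]] :=
      germI masureM s_germ (shift p) (shift q).
    by exists u, u'; split; rewrite -?xu //; exact: subset_closure.
  (* By [rho_splus], every pair in [U] for (p, q) also lies in [U] for (rho p, rho q), so the latter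
     infimum is over a larger set. *)
  apply: lb_le_inf.
    by exists (N u + N u'), (u, u').
  move=> _ [[v v'] /= [v0 v'0 ev] <-]; apply: ge_inf.
    by exists 0 => _ [uu _ <-]; rewrite addr_ge0 // norm_ge0.
  by exists (v, v') => //; split=> //=; rewrite -!rho_splus // ev.
- move=> p q Ap Aq.
  have [x <-] := isomw_surj masureM A_apt psiA Ap.
  have [y <-] := isomw_surj masureM A_apt psiA Aq.
  have mphi : modelIsom B (phi \o psi).
    by move=> f fB; have [a av e] := phi_isom psi f psiA fB; exists a.
  (* A and B each contain an element of s; the intersection contains a subsector, which phi fixes.
     Hence phi carries a chart of A at s to one of B at s. *)
  have phis : fmap (phi \o psi) (@germ_infty R S) = s.
    rewrite -[RHS]psis.
    have [E sE EA] := A_s; have [F sF FB] := B_s.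
    move: sE sF; rewrite -psis => /germ_inftyI EF /EF /germ_inftyP[z zEF].
    apply: (fmap_germ_eq (y := z)) => c /zEF [Ec Fc].
    by apply: phi_fix; split; [exact: EA|exact: FB].
  by rewrite (distE A) // -[phi (psi x)]/((phi \o psi) x)
    -[phi (psi y)]/((phi \o psi) y) (distE B).
Qed.
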